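(* Let $\mathcal{R}$ and $\mathcal{B}$ be independent translation-invariant ergodic point processes on $\mathbb{R}^d$ with equal finite, positive intensity such that the point process $\mathcal{R}+\mathcal{B}$ is simple and almost surely is non-equidistant and has no descending chains. If $\mathcal{R}$ or $\mathcal{B}$ is deletion-tolerant or insertion-tolerant, then the two-colour stable matching scheme of $\mathcal{R}$ and $\mathcal{B}$ satisfies $\mathbb{E}^*X^d=\infty$, where $X$ is a random variable with distribution function $\mathbb{P}^*(X\le r)=F(r)$, $r\ge 0$, with $F$ the distribution function of the typical matching distance.
   Context: Point processes are always simple and locally finite, i.e. random elements of the space $\mathbb{M}$ of simple locally finite point measures on $\mathbb{R}^d$, equipped with the $\sigma$-field generated by the evaluations $\mu\mapsto\mu(A)$, $A$ Borel. The support of $\mu\in\mathbb{M}$ is $[\mu]=\{y:\mu(\{y\})=1\}$. A point process is translation-invariant if its law is invariant under all translations of $\mathbb{R}^d$, and ergodic if moreover every translation-invariant event has probability $0$ or $1$. The intensity of $\Pi$ is $\mathbb{E}\,\Pi([0,1]^d)$. $\|\cdot\|$ is the Euclidean norm. For random variables $X,Y$ with values in the same measurable space, $X\prec Y$ means that $\mathbb{P}(Y\in\mathcal{A})=0$ implies $\mathbb{P}(X\in\mathcal{A})=0$ for all measurable $\mathcal{A}$. A point process $\Pi$ is insertion-tolerant if for every Borel set $S\subseteq\mathbb{R}^d$ with Lebesgue measure in $(0,\infty)$, if $U$ is uniformly distributed on $S$ and independent of $\Pi$, then $\Pi+\delta_U\prec\Pi$, where $\delta_x$ is the point measure at $x$.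 A $\Pi$-point is an $\mathbb{R}^d$-valued random variable $Z$ with $Z\in[\Pi]$ almost surely; $\Pi$ is deletion-tolerant if $\Pi-\delta_Z\prec\Pi$ for every $\Pi$-point $Z$. $\mu\in\mathbb{M}$ has a descending chain if there exist $x_1,x_2,\ldots\in[\mu]$ with $\|x_{i-1}-x_i\|>\|x_i-x_{i+1}\|$ for all $i$. $\mu$ is non-equidistant if for all $x,y,u,v\in[\mu]$ with $\{x,y\}\ne\{u,v\}$ and $x\neq y$ we have $\|x-y\|\neq\|u-v\|$. A two-colour matching scheme for $\mathcal{R}$ and $\mathcal{B}$ is a point process $\mathcal{M}$ of unordered pairs $\{x,y\}\subset\mathbb{R}^d$ such that almost surely $[\mathcal{M}]$ is the edge set of a simple bipartite graph with vertex classes $[\mathcal{R}]$, $[\mathcal{B}]$ in which every vertex has degree exactly one; write $\mathcal{M}(x)=y$ iff $\{x,y\}\in[\mathcal{M}]$. It is stable if almost surely there do not exist $x\in[\mathcal{R}]$ and $y\in[\mathcal{B}]$ with $\|x-y\|<\min\{\|x-\mathcal{M}(x)\|,\|y-\mathcal{M}(y)\|\}$. ''The'' two-colour stable matching scheme $\mathcal{M}$ is the almost surely unique such scheme, which is an isometry-equivariant factor and is constructed by iteratively matching and removing mutually closest $\mathcal{R}$/$\mathcal{B}$ pairs. Define $$F(r)=\big(\mathbb{E}\,\mathcal{R}([0,1)^d)\big)^{-1}\,\mathbb{E}\,\#\{x\in[\mathcal{R}]\cap[0,1)^d:\ \|x-\mathcal{M}(x)\|\le r\},$$ and let $X$ be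 a random variable with probability measure $\mathbb{P}^*$ and expectation $\mathbb{E}^*$ such that $\mathbb{P}^*(X\le r)=F(r)$ for all $r\ge0$. *)

(* Defs.v *)
From HB Require Import structures.
From mathcomp Require Import all_boot all_order all_algebra.
From mathcomp Require Import all_classical all_reals all_analysis.
From mathcomp Require Import measurable_realfun.

Set Implicit Arguments.
Unset Strict Implicit.
Unset Printing Implicit Defensive.

Import Order.TTheory GRing.Theory Num.Theory.
Import numFieldNormedType.Exports.

Local Open Scope classical_set_scope.
Local Open Scope ring_scope.

(** ** Euclidean space as a Borel space *)

Section borel_matrix.
Context (R : realType) (m n : nat).

HB.instance Definition _ :=
  @isMeasurable.Build (sigma_display (@open 'M[R]_(m, n))) 'M[R]_(m, n)
    <<s @open 'M[R]_(m, n) >> (@sigma_algebra0 _ setT _)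
    (@sigma_algebraC _ _) (@sigma_algebra_bigcup _ setT _).

Lemma measurable_mx_set1 (x : 'M[R]_(m, n)) : measurable [set x].
Proof.
rewrite -[[set x]]setCK; apply: measurableC; apply: sub_sigma_algebra.
apply: closed_openC; apply: accessible_closed_set1.
exact/hausdorff_accessible/norm_hausdorff.
Qed.

Lemma measurable_mx_shift (y : 'M[R]_(m, n)) :
  measurable_fun [set: 'M[R]_(m, n)] (fun x => x + y).
Proof.
apply: (@measurability _ _ _ _ _ _ (@open 'M[R]_(m, n))) => //.
move=> _ [B oB <-]; rewrite setTI; apply: sub_sigma_algebra.
by apply: open_comp => // x _; exact: (cvgD cvg_id (cvg_cst y)).
Qed.

End borel_matrix.

Section euclidean.
Context (R : realType).

(* The library norm of ['rV[R]_d] is the sup norm. *)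
Definition enorm (d : nat) (x : 'rV[R]_d) : R :=
  Num.sqrt (\sum_(i < d) x 0 i ^+ 2).

Definition unit_cube (d : nat) : set 'rV[R]_d :=
  [set x | forall i, 0 <= x 0 i < 1].

Definition closed_unit_cube (d : nat) : set 'rV[R]_d :=
  [set x | forall i, 0 <= x 0 i <= 1].

(* Lebesgue measure of Borel sets of R^d: the iterated product, where
   [lebesgue_rV d.+1] is the image of [lebesgue_measure \x lebesgue_rV d]
   under [(a, v) |-> row_mx a v]. *)
Fixpoint lebesgue_rV (d : nat) : set 'rV[R]_d -> \bar R :=
  match d return set 'rV[R]_d -> \bar R with
  | 0%N => fun A => \d_(0 : 'rV[R]_0) A
  | d'.+1 => fun A => (\int[@lebesgue_measure R]_a
      lebesgue_rV [set v : 'rV[R]_d' | A (row_mx (a%:M : 'rV[R]_1) v)])%E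
  end.

End euclidean.

(** ** Random elements *)

Section random_elements.
Context (R : realType).

Definition indep_rv d d1 d2 (Omega : measurableType d)
    (S1 : measurableType d1) (S2 : measurableType d2)
    (P : probability Omega R) (X : Omega -> S1) (Y : Omega -> S2) : Prop :=
  forall (A : set S1) (B : set S2), measurable A -> measurable B ->
    P (X @^-1` A `&` Y @^-1` B) = (P (X @^-1` A) * P (Y @^-1` B))%E.

Definition same_law d d' d1 (Omega : measurableType d)
    (Omega' : measurableType d') (S : measurableType d1)
    (P : probability Omega R) (X : Omega -> S)
    (P' : probability Omega' R) (Y : Omega' -> S) : Prop :=
  forall A : set S, measurable A -> P (X @^-1` A) = P' (Y @^-1` A).

(* X (under P) ≺ Y (under P') *)
Definition law_dominated d d' d1 (Omega : measurableType d)
    (Omega' : measurableType d') (S : measurableType d1)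
    (P : probability Omega R) (X : Omega -> S)
    (P' : probability Omega' R) (Y : Omega' -> S) : Prop :=
  forall A : set S, measurable A -> P' (Y @^-1` A) = 0%E ->
    P (X @^-1` A) = 0%E.

End random_elements.

(** ** Spaces of measures and point processes *)

Section measure_space.
Context d (T : measurableType d) (R : realType).

Definition measures : Type := {measure set T -> \bar R}.

HB.instance Definition _ := gen_eqMixin measures.
HB.instance Definition _ := gen_choiceMixin measures.
HB.instance Definition _ := isPointed.Build measures (@mzero d T R).

Definition evaluation_sets : set (set measures) :=
  \bigcup_(A in measurable)
    preimage_set_system [set: measures] (fun mu : measures => mu A) measurable.

(* All measures on T, with the sigma-field generated by the evaluations at
   measurable sets; the simple locally finite point measures are singled out
   by [simple_lf] and carry the trace sigma-field.  Working in the larger space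
   makes [measure_add] available when the sum need not be simple. *)
Definition Measures : measurableType evaluation_sets.-sigma :=
  g_sigma_algebraType evaluation_sets.

Definition atoms (mu : Measures) : set T :=
  [set y | (mu : measures) [set y] = 1%E].

(* [bdd] is the family of bounded sets, on which a locally finite measure has
   to be finite. *)
Definition simple_lf (bdd : set (set T)) (mu : Measures) : Prop :=
  exists2 D : set T, (forall K, bdd K -> finite_set (D `&` K)) &
    forall A, measurable A -> (mu : measures) A = (\esum_(x in D) \d_x A)%E.

Definition madd (mu nu : Measures) : Measures :=
  measure_add (mu : measures) (nu : measures).

Definition point_process d' (Omega : measurableType d') (bdd : set (set T))
    (Pi : Omega -> Measures) : Prop :=
  measurable_fun setT Pi /\ forall w, simple_lf bdd (Pi w).

Definition mean_measure d' (Omega : measurableType d')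
    (P : probability Omega R) (Pi : Omega -> Measures) (A : set T) : \bar R :=
  (\int[P]_w (Pi w : measures) A)%E.

End measure_space.

(** ** Point processes on R^d *)

Section shifted_measure.
Context (R : realType) (m n : nat) (mu : {measure set 'M[R]_(m, n) -> \bar R})
  (y : 'M[R]_(m, n)).

Definition shifted (A : set 'M[R]_(m, n)) : \bar R :=
  pushforward mu (fun x => x + y) A.

Let shifted0 : shifted set0 = 0%E.
Proof. by rewrite /shifted /pushforward preimage_set0 measure0. Qed.

Let shifted_ge0 A : (0 <= shifted A)%E.
Proof. by rewrite /shifted /pushforward measure_ge0. Qed.

Let shifted_sigma_additive : semi_sigma_additive shifted.
Proof.
apply: (@measure_semi_sigma_additive _ _ _ (pushforward mu (fun x => x + y))).
exact: measurable_mx_shift.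
Qed.

HB.instance Definition _ := isMeasure.Build _ _ _ shifted
  shifted0 shifted_ge0 shifted_sigma_additive.

End shifted_measure.

Section point_processes.
Context (R : realType) (d : nat).
Local Notation E := 'rV[R]_d.
Local Notation N := (Measures E R).

Definition bounded_rV : set (set E) := [set K | bounded_set K].

Definition translate (y : E) (mu : N) : N := shifted (mu : measures E R) y.

Definition add_point (mu : N) (z : E) : N :=
  madd mu (\d_z : {measure set E -> \bar R}).

(* mu - \d_z for z in the support of mu, see [remove_pointE]. *)
Definition remove_point (mu : N) (z : E) : N :=
  mrestr (mu : measures E R) (measurableC (measurable_mx_set1 z)).

Lemma remove_pointE (mu : N) (z : E) (A : set E) : measurable A -> atoms mu z ->
  (mu : measures E R) A = ((remove_point mu z : measures E R) A + \d_z A)%E.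
Proof.
move=> mA muz; have mz := measurable_mx_set1 z.
have -> : (remove_point mu z : measures E R) A = (mu : measures E R) (A `&` ~` [set z]).
  by [].
rewrite (measureDI _ mA mz).
rewrite -setDE diracE; congr (_ + _)%E.
have [Az|nAz] := pselect (A z).
  by rewrite (mem_set Az) setIidr// => x ->.
rewrite (memNset nAz) (_ : A `&` [set z] = set0) ?measure0//.
by rewrite -subset0 => x [Ax xz]; apply: nAz; rewrite -xz.
Qed.

Section processes.
Context disp (Omega : measurableType disp) (P : probability Omega R).

Definition intensity (Pi : Omega -> N) : \bar R :=
  mean_measure P Pi (@closed_unit_cube R d).

Definition translation_invariant (Pi : Omega -> N) : Prop :=
  forall y : E, same_law P (fun w => translate y (Pi w)) P Pi.

(* Invariance of an event only matters on simple locally finite measures. *)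
Definition ergodic (Pi : Omega -> N) : Prop :=
  translation_invariant Pi /\
  forall A : set N, measurable A ->
    (forall mu y, simple_lf bounded_rV mu -> A (translate y mu) <-> A mu) ->
    P (Pi @^-1` A) = 0%E \/ P (Pi @^-1` A) = 1%E.

Definition uniform_on (S : set E) (U : Omega -> E) : Prop :=
  measurable_fun setT U /\
  forall A, measurable A ->
    P (U @^-1` A) = (lebesgue_rV (A `&` S) / lebesgue_rV S)%E.

End processes.

(* U may need a larger probability space than the one carrying Pi, so the
   condition, which only depends on the law of Pi, ranges over all couplings of
   a copy of Pi with an independent U. *)
Definition insertion_tolerant disp (Omega : measurableType disp)
    (P : probability Omega R) (Pi : Omega -> N) : Prop :=
  forall S : set E, measurable S ->
  (0 < lebesgue_rV S)%E -> (lebesgue_rV S < +oo)%E ->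
  forall disp' (Omega' : measurableType disp') (P' : probability Omega' R)
    (Pi' : Omega' -> N) (U : Omega' -> E),
    point_process bounded_rV Pi' -> same_law P' Pi' P Pi ->
    uniform_on P' S U -> indep_rv P' U Pi' ->
    law_dominated P' (fun w => add_point (Pi' w) (U w)) P Pi.

Definition deletion_tolerant disp (Omega : measurableType disp)
    (P : probability Omega R) (Pi : Omega -> N) : Prop :=
  forall Z : Omega -> E, measurable_fun setT Z ->
    {ae P, forall w, atoms (Pi w) (Z w)} ->
    law_dominated P (fun w => remove_point (Pi w) (Z w)) P Pi.

Definition descending_chain (mu : N) : Prop :=
  exists x : nat -> E, (forall i, atoms mu (x i)) /\
    forall i, enorm (x i.+1 - x i.+2) < enorm (x i - x i.+1).

Definition non_equidistant (mu : N) : Prop :=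
  forall x y u v : E,
    atoms mu x -> atoms mu y -> atoms mu u -> atoms mu v ->
    [set x; y] <> [set u; v] -> x <> y ->
    enorm (x - y) <> enorm (u - v).

End point_processes.

(** ** Unordered pairs *)

Section unordered_pairs.
Context d (T : measurableType d).

(* This includes the degenerate pairs {x, x} = {x}. *)
Definition upair : Type := {e : set T | exists x y, e = [set x; y]}.

Definition mk_upair (x y : T) : upair :=
  exist _ [set x; y] (ex_intro _ x (ex_intro _ y erefl)).

HB.instance Definition _ := gen_eqMixin upair.
HB.instance Definition _ := gen_choiceMixin upair.
HB.instance Definition _ := isPointed.Build upair (mk_upair point point).

(* The quotient of the product sigma-field. *)
Definition upair_sets : set (set upair) :=
  image_set_system [set: T * T] (fun xy => mk_upair xy.1 xy.2) measurable.

Definition Upair : measurableType upair_sets.-sigma :=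
  g_sigma_algebraType upair_sets.

Definition incident (x : T) (e : Upair) : Prop := sval (e : upair) x.

End unordered_pairs.

(** ** Two-colour stable matchings *)

Section matchings.
Context (R : realType) (d : nat).
Local Notation E := 'rV[R]_d.

Definition bounded_upairs : set (set (Upair E)) :=
  [set K | bounded_set [set x : E | exists2 e, K e & incident x e]].

(* [edges] is the edge set of a simple bipartite graph with vertex classes
   [V1] and [V2] in which every vertex has degree exactly one. *)
Definition perfect_bipartite_matching (V1 V2 : set E) (edges : set (Upair E))
    : Prop :=
  [/\ V1 `&` V2 = set0,
      (forall e, edges e ->
         exists x y, [/\ V1 x, V2 y & e = mk_upair x y]) &
      (forall x, (V1 `|` V2) x -> exists! e, edges e /\ incident x e)].

(* m(x); arbitrary unless x has exactly one partner in m. *)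
Definition partner (m : Measures (Upair E) R) (x : E) : E :=
  xget 0 [set y | atoms m (mk_upair x y)].

Section schemes.
Context disp (Omega : measurableType disp) (P : probability Omega R).
Context (red blue : Omega -> Measures E R) (m : Omega -> Measures (Upair E) R).

Definition matching_scheme : Prop :=
  point_process bounded_upairs m /\
  {ae P, forall w,
    perfect_bipartite_matching (atoms (red w)) (atoms (blue w))
      (atoms (m w))}.

Definition stable_matching_scheme : Prop :=
  matching_scheme /\
  {ae P, forall w, ~ exists x y,
    [/\ atoms (red w) x, atoms (blue w) y &
        enorm (x - y) < Num.min (enorm (x - partner (m w) x))
                                (enorm (y - partner (m w) y))]}.

(* The distribution function F of the typical matching distance. *)
Definition matching_distance_cdf (r : R) : \bar R :=
  ((mean_measure P red (@unit_cube R d))^-1 *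
   \int[P]_w counting [set x | [/\ atoms (red w) x, unit_cube x &
                                   (enorm (x - partner (m w) x) <= r)%R]])%E.

End schemes.
End matchings.

(* Main.v *)
(* Suppose [E X^d < oo].  Summing over unit cubes, almost surely only finitely
   many matched pairs (x, y) are longer than a fixed fraction of their distance
   to the origin.

   Without descending chains, the matching is the set [stable_pair] of pairs
   obtained by iteration from the configurations alone.  This set is measurable
   and equivariant, so its statistics inherit the translation invariance of the
   joint law of red and blue, and "every point has exactly one partner" is a
   measurable event of full probability ([good_pairs]).  Tolerance transports
   this event through any number of insertions or deletions of red points, the
   other colour being independent.

   Adding red points can only bring blue points closer to their partners and
   push red points away, since a violation would start a descending chain.
   Insertion: put into the unit cube more red points than there are long pairs;
   their new partners come from distinct long pairs, a contradiction.  Deletion: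
   remove the red points of all long pairs; a blue point of the unit cube then
   gets a red partner that belonged to a long pair, a contradiction. *)
Require Import Defs.
From HB Require Import structures.
From mathcomp Require Import all_boot all_order all_algebra finmap.
From mathcomp Require Import all_classical all_reals all_analysis.
From mathcomp Require Import measurable_realfun.
From mathcomp Require Import lra zify.

Set Implicit Arguments.
Unset Strict Implicit.
Unset Printing Implicit Defensive.

Import Order.TTheory GRing.Theory Num.Theory.
Import numFieldNormedType.Exports.

Local Open Scope classical_set_scope.
Local Open Scope ring_scope.

(** * Borel sets of Euclidean space *)

(** Tolerance compares laws only, whereas the given matching [m] lives on one probability space and
    says nothing about modified configurations. Hence [m] serves only to show that an event about
    pairs of configurations has probability one, and only this event is transported.

    The points to be inserted or deleted depend on the sample, while a tolerance hypothesis moves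
    one null event by one random point. So deletions run over countably many rules given by rational
    balls, insertions over almost every point of the cube, and the event is made stable under [k]
    modifications for every [k] at once. A suitable finite sequence of modifications is then chosen
    separately for each sample.

    Absence of descending chains is not transported. Both comparisons assume it only for the
    configuration with fewer red points: after a deletion it is inherited, and for an insertion this
    is the original configuration. *)

Section euclidean_measurability.
Context (R : realType).

Lemma enorm_sym d (x y : 'rV[R]_d) : enorm (x - y) = enorm (y - x).
Proof.
rewrite /enorm; congr Num.sqrt; apply: eq_bigr => i _.
by rewrite !mxE -sqrrN opprB.
Qed.

Lemma enorm_ge0 d (x : 'rV[R]_d) : 0 <= enorm x.
Proof. exact: sqrtr_ge0. Qed.

Lemma coord_le_norm d (x : 'rV[R]_d) i : `|x 0 i| <= `|x|.
Proof.
rewrite -[leRHS]/(mx_norm x) mx_normrE.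
exact: (le_bigmax _ (fun ij : 'I_1 * 'I_d => `|x ij.1 ij.2|) (0, i)).
Qed.

Lemma norm_le_coord d (x : 'rV[R]_d) (r : R) : 0 <= r ->
  (forall i, `|x 0 i| <= r) -> `|x| <= r.
Proof.
move=> r0 xr; rewrite -[leLHS]/(mx_norm x) mx_normrE; apply: bigmax_le => // -[i j] _ /=.
by rewrite (ord1 i).
Qed.

Lemma norm_le_enorm d (x : 'rV[R]_d) : `|x| <= enorm x.
Proof.
apply: norm_le_coord => [|i]; first exact: enorm_ge0.
rewrite -sqrtr_sqr ler_wsqrtr// (bigD1 i)//= lerDl.
by apply: sumr_ge0 => j _; exact: sqr_ge0.
Qed.

Lemma enorm_gt0 d (x y : 'rV[R]_d) : x <> y -> 0 < enorm (x - y).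
Proof.
move=> xy; apply: lt_le_trans (norm_le_enorm _).
by rewrite normr_gt0 subr_eq0; apply/eqP.
Qed.

Lemma measurable_coord d (i : 'I_d) :
  measurable_fun [set: 'rV[R]_d] (fun x => x 0 i).
Proof.
apply: (measurability _ (RGenOpens.measurableE R)) => _ [_ [a [b ->]] <-].
rewrite setTI; apply: sub_sigma_algebra.
by apply: open_comp => [x _|]; [exact: coord_continuous|exact: interval_open].
Qed.

(** A countable base of sup norm balls indexed by [nat]. It reduces measurability to coordinates and
    later singles out one point of a configuration. *)
Definition rat_ball d (n : nat) : set 'rV[R]_d :=
  if choice.unpickle n is Some (q, k)
  then ball (map_mx ratr (q : 'rV[rat]_d) : 'rV[R]_d) (k.+1%:R^-1) else set0.

Lemma rat_ballP d (x : 'rV[R]_d) (e : R) : 0 < e ->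
  exists2 n, rat_ball n x & rat_ball n `<=` ball x e.
Proof.
move=> e0; pose k := Num.trunc (2 / e).
have ke : k.+1%:R^-1 < e / 2.
  rewrite -[ltRHS]invf_div ltf_pV2 ?posrE ?divr_gt0//.
  exact: truncnS_gt.
have k0 : (0 : R) < k.+1%:R^-1 by rewrite invr_gt0.
have /choice[q qx] (i : 'I_d) : exists q : rat, `|ratr q - x 0 i| < k.+1%:R^-1.
  have /rat_in_itvoo[q] : x 0 i - k.+1%:R^-1 < x 0 i + k.+1%:R^-1.
    by rewrite ltrBlDr -addrA ltrDl addr_gt0.
  rewrite in_itv/= => /andP[q1 q2]; exists q; by rewrite ltr_distl q1 q2.
have xq : ball (map_mx ratr (\row_i q i) : 'rV[R]_d) k.+1%:R^-1 x.
  by split => // a b; rewrite (ord1 a) /ball/= !mxE.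
exists (choice.pickle (\row_i q i, k)); rewrite /rat_ball choice.pickleK => // y qy.
rewrite (splitr e); apply: (@ball_triangle _ _ (map_mx ratr (\row_i q i) : 'rV[R]_d)).
  by apply: ball_sym; apply: le_ball xq; exact: ltW.
by apply: le_ball qy; exact: ltW.
Qed.

Lemma open_rat_ball d (A : set 'rV[R]_d) : open A ->
  A = \bigcup_(q in [set q | rat_ball q `<=` A]) rat_ball q.
Proof.
move=> oA; apply/seteqP; split => [x Ax|x [q/= qA]]; last exact: qA.
have /nbhs_ballP[e /= e0 xeA] := open_nbhs_nbhs (conj oA Ax).
have [q qx qxe] := rat_ballP x e0.
by exists q => //=; apply: subset_trans xeA.
Qed.

(** An open set is a countable union of rational balls, and a sup norm ball is a finite intersection
    of conditions on single coordinates. *)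
Lemma measurable_rV dT (T : measurableType dT) d (f : T -> 'rV[R]_d) :
  (forall i, measurable_fun setT (fun t => f t 0 i)) -> measurable_fun setT f.
Proof.
move=> mf; apply: (@measurability _ _ _ _ _ _ (@open 'rV[R]_d)) => //.
move=> _ [B oB <-]; rewrite setTI (open_rat_ball oB) preimage_bigcup.
apply: bigcup_measurable => n _; rewrite /rat_ball.
case: (choice.unpickle n) => [[q k]|]; last by rewrite preimage_set0.
rewrite (_ : _ @^-1` _ = \bigcap_(i in [set: 'I_d])
    (fun t => f t 0 i) @^-1` ball (ratr (q 0 i) : R) k.+1%:R^-1).
  apply: fin_bigcap_measurable => // i _; rewrite -[X in measurable X]setTI.
  by apply: mf => //; apply: open_measurable; exact: ball_open.
apply/seteqP; split => [t [_ qt] i _|t qt] /=.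
  by have := qt 0 i; rewrite mxE.
split => [|a b]; first by rewrite invr_gt0.
by have := qt b I; rewrite (ord1 a) /ball/= mxE.
Qed.

Lemma measurable_rat_ball d n : measurable (@rat_ball d n).
Proof.
rewrite /rat_ball; case: (choice.unpickle n) => [[q k]|] //.
by apply: sub_sigma_algebra; exact: ball_open.
Qed.

Lemma measurable_enorm_sub dT (T : measurableType dT) d (f g : T -> 'rV[R]_d) :
  measurable_fun setT f -> measurable_fun setT g ->
  measurable_fun setT (fun t => enorm (f t - g t)).
Proof.
move=> mf mg; have ms : measurable_fun [set: R] Num.sqrt.
  by apply: continuous_measurable_fun; exact: sqrt_continuous.
apply: (measurableT_comp ms).
apply: measurable_sum => i; apply: measurable_funX.
under eq_fun do rewrite !mxE.
apply: measurable_funB; first exact: (measurableT_comp (measurable_coord i) mf).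
exact: (measurableT_comp (measurable_coord i) mg).
Qed.

Lemma measurable_enorm_lt dT (T : measurableType dT) d (f g f' g' : T -> 'rV[R]_d) :
  measurable_fun setT f -> measurable_fun setT g ->
  measurable_fun setT f' -> measurable_fun setT g' ->
  measurable [set t | enorm (f t - g t) < enorm (f' t - g' t)].
Proof.
move=> mf mg mf' mg'; rewrite -[X in measurable X]setTI.
have := measurable_fun_ltr (measurable_enorm_sub mf mg) (measurable_enorm_sub mf' mg').
by move=> /(_ measurableT [set true]); apply.
Qed.

End euclidean_measurability.

(** * Measurability on spaces of measures *)

Section measures_measurability.
Context d (T : measurableType d) (R : realType).
Local Notation N := (Measures T R).

Lemma measurable_eval (A : set T) : measurable A ->
  measurable_fun [set: N] (fun mu : N => (mu : measures T R) A).
Proof.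
move=> mA _ B mB; rewrite setTI; apply: sub_sigma_algebra.
by exists A => //; exists B => //; rewrite setTI.
Qed.

Lemma measurable_Measures d' (S : measurableType d') (f : S -> N) :
  (forall A, measurable A ->
     measurable_fun [set: S] (fun s => (f s : measures T R) A)) ->
  measurable_fun setT f.
Proof.
move=> mf; apply: (@measurability _ _ S N setT f (@evaluation_sets d T R)) => //.
move=> _ [_ [A mA [B mB <-]] <-]; rewrite !setTI.
by rewrite -[X in measurable X]setTI; exact: (mf A mA measurableT B mB).
Qed.

(** Measures agreeing on all measurable sets may still be distinct elements of [N]. The sets that
    cannot tell them apart form a sigma-field containing the evaluation sets. *)
Lemma measurable_Measures_ext (X : set N) (mu nu : N) : measurable X ->
  (forall A, measurable A ->
     (mu : measures T R) A = (nu : measures T R) A) -> X mu <-> X nu.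
Proof.
move=> mX munu.
suff : <<s @evaluation_sets _ T R >> `<=` [set Y : set N | Y mu <-> Y nu] by apply.
apply: smallest_sub => [|Y [A mA [B mB <-]]]; last first.
  by split => -[_ /= BA]; split => //=; move: BA; rewrite munu.
split => /=.
- by [].
- by move=> Y IH; split => -[_ nY]; split => // Yx; apply: nY; apply/IH.
- by move=> F FE; split => -[n _ Fn]; exists n => //; apply/FE.
Qed.

End measures_measurability.

(** * Integer cubes and measurability of sections of random measures *)

Section integer_cubes.
Context (R : realType) (d : nat).
Local Notation E := 'rV[R]_d.

Definition int_cube (z : 'rV[int]_d) : set E :=
  [set x | forall i, (z 0 i)%:~R <= x 0 i < (z 0 i)%:~R + 1].

(** [pickle_inv], unlike [unpickle], gives each cube exactly one index, so the family is disjoint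
    and sums over [n] are sums over the lattice. *)
Definition nat_cube (n : nat) : set E :=
  if pickle_inv n is Some z then int_cube z else set0.

Lemma measurable_int_cube z : measurable (int_cube z).
Proof.
rewrite (_ : int_cube z = \bigcap_(i in [set: 'I_d])
    (fun x : E => x 0 i) @^-1` `[(z 0 i)%:~R, (z 0 i)%:~R + 1[%classic).
  apply: fin_bigcap_measurable => // i _; rewrite -[X in measurable X]setTI.
  by apply: measurable_coord.
apply/seteqP; split => [x zx i _|x zx i] /=; first by rewrite in_itv/=.
by have := zx i I; rewrite /= in_itv.
Qed.

Lemma measurable_nat_cube n : measurable (nat_cube n).
Proof.
by rewrite /nat_cube; case: pickle_inv => [z|//]; exact: measurable_int_cube.
Qed.

Definition int_part (x : E) : 'rV[int]_d := \row_i Num.floor (x 0 i).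

Lemma int_cubeP x z : int_cube z x <-> z = int_part x.
Proof.
split => [zx|-> i]; last by rewrite mxE; have := floor_itv (x 0 i); rewrite intrD.
apply/rowP => i; rewrite mxE; apply/esym/floor_def.
by rewrite intrD.
Qed.

Lemma trivIset_nat_cube : trivIset setT nat_cube.
Proof.
apply/trivIsetP => i j _ _ ij; rewrite -subset0 => x [].
rewrite /nat_cube; have := @pickle_invK 'rV[int]_d i; have := @pickle_invK 'rV[int]_d j.
case: (pickle_inv i) => [y|//]; case: (pickle_inv j) => [z|//]; rewrite /oapp => jE iE.
by move/eqP: ij; rewrite -iE -jE => ij /int_cubeP yx /int_cubeP zx; apply: ij; rewrite yx zx.
Qed.

Lemma bigcup_nat_cube : \bigcup_n nat_cube n = [set: E].
Proof.
rewrite -subTset => x _; exists (choice.pickle (int_part x)) => //.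
by rewrite /nat_cube pickleK_inv; apply/int_cubeP.
Qed.

Lemma bounded_int_cube z : bounded_set (int_cube z).
Proof.
exists (\big[Num.max/0]_i (`|(z 0 i)%:~R| + 1)); split; first exact: num_real.
move=> r /ltW zr x zx; have r0 : 0 <= r by apply: le_trans zr; exact: bigmax_ge_id.
apply: norm_le_coord => // i; apply: le_trans zr.
apply: le_trans (le_bigmax _ (fun i => `|(z 0 i)%:~R| + 1 : R) i).
have := zx i; move: (x 0 i) ((z 0 i)%:~R) => a b /andP[ba ab].
have -> : a = b + (a - b) by rewrite addrC subrK.
apply: le_trans (ler_normD _ _) _; rewrite lerD2l ger0_norm ?subr_ge0//.
by rewrite lerBlDl ltW.
Qed.

Lemma int_cube0 : int_cube 0 = @unit_cube R d.
Proof.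
by apply/seteqP; split => x + i => /(_ i); rewrite mxE add0r.
Qed.

Lemma measurable_unit_cube : measurable (@unit_cube R d).
Proof. by rewrite -int_cube0; exact: measurable_int_cube. Qed.

(* The measures that are infinite on some cube are discarded, so that
   sections are measurable in the measure. *)
Definition cube_finite (mu : Measures E R) : Prop :=
  forall n, ((mu : measures E R) (nat_cube n) < +oo)%E.

Definition regular (mu : Measures E R) : Measures E R :=
  if `[< cube_finite mu >] then mu else @mzero _ E R.

Lemma regularE mu : cube_finite mu -> regular mu = mu.
Proof. by move=> mu_fin; rewrite /regular asboolT. Qed.

Lemma cube_finite_regular mu : cube_finite (regular mu).
Proof.
by rewrite /regular; case: asboolP => // _ n; rewrite /= /mzero ltry.
Qed.

Lemma measurable_cube_finite : measurable [set mu | cube_finite mu].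
Proof.
rewrite (_ : [set mu | _] = \bigcap_n
    (fun mu : Measures E R => (mu : measures E R) (nat_cube n)) @^-1` [set~ +oo%E]).
  apply: bigcapT_measurable => n; rewrite -[X in measurable X]setTI.
  by apply: (measurable_eval (measurable_nat_cube n)) => //; exact: measurableC.
apply/seteqP; split => [mu mu_fin n _|mu mu_fin n] /=.
  by move=> h; have := mu_fin n; rewrite h.
by rewrite ltey; apply/eqP; exact: mu_fin.
Qed.

Lemma measurable_regular : measurable_fun setT regular.
Proof.
apply: (@measurable_fun_ifT _ _ _ _ id (fun=> @mzero _ E R : Measures E R)
  (fun mu => `[< cube_finite mu >])) => //.
apply: (measurable_fun_bool true); rewrite setTI.
rewrite (_ : _ @^-1` _ = [set mu | cube_finite mu]).
  exact: measurable_cube_finite.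
by apply/seteqP; split => mu /= /asboolP.
Qed.

(** On one cube the measures are finite, so the section theorem for kernels applies; summing over
    the cubes gives the general case. Every later event asking for a point that satisfies a
    condition depending on the configuration is measurable through this. *)
Lemma measurable_regular_section dT (T : measurableType dT)
    (f : T -> Measures E R) (A : set (T * E)) :
  measurable_fun setT f -> measurable A ->
  measurable_fun setT (fun t => (regular (f t) : measures E R) [set x | A (t, x)]).
Proof.
move=> mf mA.
have mrf : measurable_fun setT (regular \o f).
  exact: measurableT_comp measurable_regular mf.
pose k t : {measure set E -> \bar R} := regular (f t).
have mk U : measurable U -> measurable_fun setT (k ^~ U).
  by move=> mU; exact: (measurableT_comp (measurable_eval mU) mrf).
pose k' : R.-ker T ~> E := HB.pack k (isKernel.Build _ _ _ _ _ k mk).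
have mAn n : measurable_fun setT
    (fun t => (regular (f t) : measures E R) ([set x | A (t, x)] `&` nat_cube n)).
  have [] := @measurable_prod_subset_xsection_kernel _ _ T E R k' _
    (measurable_nat_cube n) _ A mA.
    move=> t; have := cube_finite_regular (f t) n.
    rewrite -ge0_fin_numE// => fin; exists (fine (k t (nat_cube n)) + 1) => X mX.
    rewrite EFinD fineK//; apply: (@le_lt_trans _ _ (k t (nat_cube n))).
      apply: le_measure; rewrite ?inE//; [|exact: measurable_nat_cube].
      by apply: measurableI => //; exact: measurable_nat_cube.
    by rewrite lteDl// lte01.
  by move=> _; under eq_fun do rewrite xsectionE.
have mAt t : measurable [set x | A (t, x)].
  by have := measurable_xsection t mA; rewrite xsectionE.
rewrite (_ : (fun t => _) = (fun t => \sum_(n <oo | n \in predT)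
    (regular (f t) : measures E R) ([set x | A (t, x)] `&` nat_cube n))%E).
  by apply: ge0_emeasurable_sum.
apply/funext => t.
have {1}-> : [set x | A (t, x)] = \bigcup_n ([set x | A (t, x)] `&` nat_cube n).
  by rewrite -setI_bigcupr bigcup_nat_cube setIT.
rewrite measure_semi_bigcup//.
- by move=> n; apply: measurableI => //; exact: measurable_nat_cube.
- by apply: trivIset_setIl; exact: trivIset_nat_cube.
- by apply: bigcup_measurable => n _; apply: measurableI => //; exact: measurable_nat_cube.
Qed.

End integer_cubes.

(** * Simple locally finite measures *)

Section counting_points.
Local Open Scope ereal_scope.
Context (R : realType) (T : choiceType).

Lemma counting_eq0 (X : set T) : @counting T R X = 0 <-> X = set0.
Proof.
split => [|->]; last by rewrite /counting asboolT// fset_set0.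
rewrite /counting; case: asboolP => // finX [] /eqP.
by rewrite pnatr_eq0 cardfs_eq0 => /eqP/fset_set_set0; exact.
Qed.

Lemma counting_set1 (x : T) : @counting T R [set x] = 1.
Proof. by rewrite /counting asboolT// fset_set1 cardfs1. Qed.

Lemma counting_eq1 (X : set T) : @counting T R X = 1 <-> exists x, X = [set x].
Proof.
split => [|[x ->]]; last exact: counting_set1.
rewrite /counting; case: asboolP => // finX [] /eqP.
rewrite pnatr_eq1 => /cardfs1P[x Xx]; exists x.
by rewrite -(fset_setK finX) Xx set_fset1.
Qed.

Lemma counting_fin (X : set T) : finite_set X -> @counting T R X < +oo.
Proof. by move=> finX; rewrite /counting asboolT// ltry. Qed.

Lemma finite_counting (X : set T) : @counting T R X < +oo -> finite_set X.
Proof. by rewrite /counting; case: asboolP. Qed.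

Lemma le_counting (X Y : set T) : X `<=` Y ->
  @counting T R X <= @counting T R Y.
Proof.
move=> XY; rewrite /counting; case: (asboolP (finite_set Y)) => [finY|]; last by rewrite leey.
have finX := sub_finite_set XY finY.
by rewrite asboolT// lee_fin ler_nat; apply/fsubset_leq_card; rewrite -fset_set_sub.
Qed.

Lemma counting_image (T' : choiceType) (f : T -> T') (X : set T) :
  injective f -> @counting T' R (f @` X) = @counting T R X.
Proof.
move=> fI; rewrite /counting.
have [finX|infX] := pselect (finite_set X).
  have finfX : finite_set (f @` X) by exact: finite_image.
  by rewrite !asboolT// fset_set_image// card_imfset.
rewrite !asboolF// => finfX; apply: infX; move: finfX.
by rewrite (eq_finite_set (inj_card_eq _))// => x y _ _; exact: fI.
Qed.

Lemma esum_one (X : set T) : \esum_(x in X) (1 : \bar R) = counting X.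
Proof.
rewrite /counting; case: asboolP => [finX|infX].
  by rewrite esum_fset// fsbig_finite//= card_fset_sum1 natr_sum -sumEFin.
apply/eqyP => r r0.
have [B BX rB] := infinite_set_fset (Num.trunc r).+1 infX.
apply: esum_ge; exists [set` B].
  by split => //; exact: finite_fset.
have -> : \sum_(x \in [set` B]) (1 : \bar R) = (#|` B|)%:R%:E.
  by rewrite fsbig_finite//= set_fsetK card_fset_sum1 natr_sum -sumEFin.
by rewrite lee_fin (le_trans (ltW (truncnS_gt r)))// ler_nat.
Qed.

Lemma counting_setU1 (X : set T) (x : T) : ~ X x ->
  @counting T R (X `|` [set x]) = counting X + 1.
Proof.
move=> nXx; rewrite -!esum_one (esumID X)//; congr (_ + _).
  by rewrite setIUl setIid (_ : [set x] `&` X = set0) ?setU0// -subset0 => y [->].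
rewrite (_ : _ `&` _ = [set x]) ?esum_set1//.
by apply/seteqP; split => [y [[//|//]]|y ->]; split => //; right.
Qed.

End counting_points.

Lemma esum_dirac (R : realType) dT (T : measurableType dT) (D A : set T) :
  (\esum_(x in D) \d_x A)%E = @counting T R (D `&` A).
Proof.
rewrite -esum_one esum_mkcondr; apply: eq_esum => x _.
by rewrite diracE; case: (x \in A).
Qed.

Section simple_points.
Context (R : realType) (d : nat).
Local Notation E := 'rV[R]_d.
Local Notation N := (Measures E R).
Local Notation slf := (simple_lf (@bounded_rV R d)).

Definition loc_finite (D : set E) : Prop :=
  forall K, bounded_set K -> finite_set (D `&` K).

Lemma bounded_set_norm_le (K : set E) : bounded_set K -> exists r, forall x, K x -> `|x| <= r.
Proof.
move=> [M [_ KM]]; exists (M + 1) => x Kx.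
by apply: (KM (M + 1)) => //; rewrite ltrDl.
Qed.

Lemma norm_le_bounded_set (K : set E) : (exists r, forall x, K x -> `|x| <= r) -> bounded_set K.
Proof.
move=> [r Kr]; exists r; split; first exact: num_real.
by move=> s /ltW rs x /Kr; move/le_trans; apply.
Qed.

(** Evaluation at singletons shows that the set hidden in [simple_lf] can only be [atoms mu]. *)
Lemma simple_lf_of_counting (mu : N) (D : set E) : loc_finite D ->
  (forall A, measurable A -> (mu : measures E R) A = counting (D `&` A)) ->
  slf mu /\ atoms mu = D.
Proof.
move=> Dlf muE; split.
  by exists D => // A mA; rewrite muE// esum_dirac.
apply/seteqP; split => [x|x Dx]; rewrite /atoms/=.
  rewrite muE; last exact: measurable_mx_set1.
  by move=> /counting_eq1[y Dy]; have : [set y] y by []; rewrite -Dy => -[+ <-].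
rewrite muE; last exact: measurable_mx_set1.
rewrite (_ : D `&` [set x] = [set x]); first exact: counting_set1.
by apply/seteqP; split => [y []//|y ->].
Qed.

Lemma simple_lfP (mu : N) : slf mu ->
  loc_finite (atoms mu) /\
  forall A, measurable A -> (mu : measures E R) A = counting (atoms mu `&` A).
Proof.
move=> [D Dlf muE].
have muE' A : measurable A -> (mu : measures E R) A = counting (D `&` A).
  by move=> mA; rewrite muE// esum_dirac.
by have [_ ->] := simple_lf_of_counting Dlf muE'.
Qed.

Lemma simple_lf_cube_finite (mu : N) : slf mu -> cube_finite mu.
Proof.
move=> /simple_lfP[mulf muE] n; rewrite muE; last exact: measurable_nat_cube.
apply: counting_fin; apply: mulf; rewrite /nat_cube.
case: pickle_inv => [z|]; first exact: bounded_int_cube.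
by apply: norm_le_bounded_set; exists 0.
Qed.

Lemma simple_lf_regular (mu : N) : slf mu -> regular mu = mu.
Proof. by move=> /simple_lf_cube_finite/regularE. Qed.

Lemma simple_lf_eq0 (mu : N) (A : set E) : slf mu -> measurable A ->
  (mu : measures E R) A = 0%E <-> forall x, atoms mu x -> ~ A x.
Proof.
move=> /simple_lfP[_ muE] mA; rewrite muE// counting_eq0; split.
  by move=> A0 x mux Ax; have : (atoms mu `&` A) x by []; rewrite A0.
by move=> nA; rewrite -subset0 => x [/nA].
Qed.

Lemma simple_lf_eq1 (mu : N) (A : set E) : slf mu -> measurable A ->
  (mu : measures E R) A = 1%E <-> exists! x, atoms mu x /\ A x.
Proof.
move=> /simple_lfP[_ muE] mA; rewrite muE// counting_eq1; split.
  move=> [x Ax]; have xA : (atoms mu `&` A) x by rewrite Ax.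
  exists x; split => // y yA; have : (atoms mu `&` A) y by [].
  by rewrite Ax => ->.
move=> [x [xA xu]]; exists x; apply/seteqP; split => [y /xu -> //|y ->]; exact: xA.
Qed.

Lemma loc_finite_sub (D D' : set E) : D `<=` D' -> loc_finite D' -> loc_finite D.
Proof. by move=> DD' D'lf K /D'lf; apply: sub_finite_set; exact: setSI. Qed.

Lemma atoms_translate (mu : N) (y : E) : slf mu ->
  slf (translate y mu) /\ atoms (translate y mu) = [set x | atoms mu (x - y)].
Proof.
move=> /simple_lfP[mulf muE]; apply: simple_lf_of_counting => [K bK|A mA].
  have [r Kr] := bounded_set_norm_le bK.
  have := mulf [set x | K (x + y)]; have bK' : bounded_set [set x | K (x + y)].
    apply: norm_le_bounded_set; exists (r + `|y|) => x /Kr xy.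
    by rewrite -(addrK y x) (le_trans (ler_normB _ _))// lerD.
  move=> /(_ bK') /(finite_image (fun x => x + y)); apply: sub_finite_set.
  by move=> x [mux Kx]; exists (x - y); rewrite ?subrK//; split => //=; rewrite subrK.
rewrite /translate/= /shifted /pushforward muE; last first.
  rewrite -[X in measurable X]setTI; exact: measurable_mx_shift.
rewrite -(@counting_image _ _ _ (fun x => x + y)); last exact: addIr.
congr counting; apply/seteqP; split => [_ [x [mux Ax] <-]|x [mux Ax]].
  by split => //=; rewrite addrK.
by exists (x - y); rewrite ?subrK//; split => //=; rewrite subrK.
Qed.

Lemma add_pointE (mu : N) (u : E) (A : set E) :
  (add_point mu u : measures E R) A = ((mu : measures E R) A + \d_u A)%E.
Proof. exact: measure_addE. Qed.

Lemma atoms_add_point (mu : N) (u : E) : slf mu -> ~ atoms mu u ->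
  slf (add_point mu u) /\ atoms (add_point mu u) = atoms mu `|` [set u].
Proof.
move=> /simple_lfP[mulf muE] nu; apply: simple_lf_of_counting => [K bK|A mA].
  rewrite setIUl finite_setU; split; first exact: mulf.
  by apply: sub_finite_set (finite_set1 u) => x [].
rewrite add_pointE muE// setIUl diracE.
have [Au|nAu] := pselect (A u).
  rewrite mem_set// (_ : [set u] `&` A = [set u]); last first.
    by apply/seteqP; split => [x []//|x ->].
  by rewrite counting_setU1// => -[].
rewrite memNset// adde0 (_ : [set u] `&` A = set0) ?setU0//.
by rewrite -subset0 => x [->].
Qed.

Lemma atoms_restr (mu : N) (B : set E) (mB : measurable B) : slf mu ->
  slf (mrestr (mu : measures E R) mB : N) /\
  atoms (mrestr (mu : measures E R) mB : N) = atoms mu `&` B.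
Proof.
move=> /simple_lfP[mulf muE]; apply: simple_lf_of_counting => [|A mA].
  by apply: loc_finite_sub mulf; exact: subIsetl.
by rewrite /= /mrestr muE ?setIA -?setIA 1?[B `&` A]setIC//; exact: measurableI.
Qed.

End simple_points.

(** * Stable pairs of two point sets *)

Section stable_pairs.
Context (R : realType) (d : nat).
Local Notation E := 'rV[R]_d.

Lemma finite_common_bound (T : Type) (A : set T) (Q : nat -> T -> Prop) :
  finite_set A -> (forall m n a, (m <= n)%N -> Q m a -> Q n a) ->
  (forall a, A a -> exists n, Q n a) -> exists n, forall a, A a -> Q n a.
Proof.
(* [T] receives a choice structure here, so that the finite set becomes an [fset] over which a
   maximum can be taken. *)
move=> finA Qle; elim/Pchoice: T => T in A Q finA Qle *.
move=> AQ; have /choice[f fQ] a : exists n, A a -> Q n a.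
  by have [/AQ[n Qn]|nA] := pselect (A a); [exists n|exists 0%N].
exists (\max_(a <- fset_set A) f a)%N => a Aa; apply: Qle (fQ a Aa).
by apply: leq_bigmax_seq; rewrite ?in_fset_set ?inE.
Qed.

Lemma seq_argmin (T : eqType) (s : seq T) (y0 : T) (f : T -> R) : y0 \in s ->
  exists2 y, y \in s & forall y', y' \in s -> f y <= f y'.
Proof.
elim: s y0 => [//|a [|b s] IH] y0 _.
  by exists a; rewrite ?inE// => y'; rewrite inE => /eqP->.
have [y ys ymin] := IH b (mem_head _ _).
have [le|lt] := leP (f a) (f y).
  exists a; first exact: mem_head.
  move=> y'; rewrite inE => /predU1P[->//|/ymin]; exact: le_trans.
exists y; first by rewrite inE ys orbT.
by move=> y'; rewrite inE => /predU1P[->|/ymin//]; exact: ltW.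
Qed.

Lemma finite_nearest (A : set E) (x : E) : A !=set0 ->
  (forall r, finite_set (A `&` [set y | enorm (x - y) <= r])) ->
  exists2 y, A y & forall y', A y' -> enorm (x - y) <= enorm (x - y').
Proof.
move=> [y0 Ay0] finA; pose B := A `&` [set y | enorm (x - y) <= enorm (x - y0)].
have finB : finite_set B by exact: finA.
have y0B : y0 \in enum_fset (fset_set B).
  by rewrite in_fset_set// inE; split => //=.
have [y yB ymin] := seq_argmin (fun y => enorm (x - y)) y0B.
have mem z : (z \in enum_fset (fset_set B)) <-> B z by rewrite in_fset_set// inE.
have [Ay yy0] := (mem y).1 yB; exists y => // y' Ay'.
have [le|lt] := leP (enorm (x - y')) (enorm (x - y0)).
  by apply: ymin; apply/mem; split.
exact: le_trans yy0 (ltW lt).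
Qed.

Lemma loc_finite_ball (V : set E) (x : E) (r : R) : loc_finite V ->
  finite_set (V `&` [set y | enorm (x - y) <= r]).
Proof.
apply; apply: norm_le_bounded_set; exists (`|x| + r) => y /= xyr.
have -> : y = x - (x - y) by rewrite opprB addrC subrK.
by apply: le_trans (ler_normB _ _) _; rewrite lerD2l (le_trans (norm_le_enorm _)).
Qed.

Definition chain_free (V : set E) : Prop :=
  ~ exists s : nat -> E, (forall i, V (s i)) /\
      forall i, enorm (s i.+1 - s i.+2) < enorm (s i - s i.+1).

Lemma chain_free_walk (V : set E) (W : E -> E -> Prop) : chain_free V ->
  (forall u v, W u v -> V u /\ exists2 w, W v w & enorm (v - w) < enorm (u - v)) ->
  forall u v, ~ W u v.
Proof.
move=> Vfree step u v Wuv; apply: Vfree.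
pose S := {uv : E * E | W uv.1 uv.2}.
have /choice[f fP] (p : S) : exists q : S, (sval q).1 = (sval p).2 /\
    enorm ((sval q).1 - (sval q).2) < enorm ((sval p).1 - (sval p).2).
  case: p => -[a b] /= Wab; have [_ [w Wbw bw]] := step _ _ Wab.
  by exists (exist _ (b, w) Wbw).
pose p n := iter n f (exist _ (u, v) Wuv : S).
exists (fun n => (sval (p n)).1); split => i.
  by case: (p i) => -[a b] /= /step[].
have [p1 lt1] := fP (p i); have [p2 _] := fP (p i.+1).
have -> : p i.+2 = f (p i.+1) by [].
by rewrite p2; move: lt1; rewrite -p1.
Qed.

Section relation.
Variables V1 V2 : set E.

Definition blocked (S : E -> E -> Prop) (x y : E) : Prop :=
  (exists y', [/\ V2 y', enorm (x - y') < enorm (x - y) & S x y']) \/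
  (exists x', [/\ V1 x', enorm (x' - y) < enorm (x - y) & S x' y]).

(* A pair enters at stage [n.+1] when each closer pair sharing a point with it
   is blocked by an even closer pair of stage [n]; without descending chains
   these are the pairs matched by the iterative construction. *)
Fixpoint stage (n : nat) (x y : E) : Prop :=
  if n is n'.+1 then ~ blocked (fun a b => ~ blocked (stage n') a b) x y
  else False.

(** Finite stages suffice because a pair has only finitely many closer competitors in locally finite
    sets; a countable union of stages also keeps the relation measurable. *)
Definition stable_pair (x y : E) : Prop := exists n, stage n x y.

Lemma blocked_sub (S S' : E -> E -> Prop) x y :
  (forall a b, S a b -> S' a b) -> blocked S x y -> blocked S' x y.
Proof.
move=> SS' [[y' [? ? ?]]|[x' [? ? ?]]]; [left; exists y'|right; exists x'];
by split => //; exact: SS'.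
Qed.

(** [blocked] is monotone and occurs under two negations, so the stages are the increasing iterates
    of a monotone operator started at the empty relation. *)
Lemma stageS n x y : stage n x y -> stage n.+1 x y.
Proof.
elim: n x y => [//|n IH] x y h1 h2; apply: h1.
by apply: blocked_sub h2 => a b h3 h4; apply: h3; exact: blocked_sub h4.
Qed.

Lemma stage_le m n x y : (m <= n)%N -> stage m x y -> stage n x y.
Proof.
move=> /subnK <-; elim: (n - m)%N => [//|k IH] /IH; rewrite addSn; exact: stageS.
Qed.

Lemma blocked_stable_pair x y :
  blocked stable_pair x y <-> exists n, blocked (stage n) x y.
Proof.
split=> [[[y' [? ? [n ?]]]|[x' [? ? [n ?]]]]|[n]].
- by exists n; left; exists y'.
- by exists n; right; exists x'.
- by apply: blocked_sub => a b; exists n.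
Qed.

(** Stability of the selected pairs, for arbitrary point sets: a closer competitor that is not
    blocked would have kept the pair out of its stage. *)
Lemma stable_pair_blocks_r x y y' : stable_pair x y -> V2 y' ->
  enorm (x - y') < enorm (x - y) -> blocked stable_pair x y'.
Proof.
case=> -[//|n] /= nb y'2 lt; apply/blocked_stable_pair; exists n.
by apply: contrapT => nbl; apply: nb; left; exists y'.
Qed.

Lemma stable_pair_blocks_l x x' y : stable_pair x y -> V1 x' ->
  enorm (x' - y) < enorm (x - y) -> blocked stable_pair x' y.
Proof.
case=> -[//|n] /= nb x'1 lt; apply/blocked_stable_pair; exists n.
by apply: contrapT => nbl; apply: nb; right; exists x'.
Qed.

(** The property transported by tolerance. It refers to the two point sets alone, hence makes sense
    for modified configurations, which carry no given matching. *)
Definition perfectly_paired : Prop :=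
  (forall x, V1 x -> exists! y, V2 y /\ stable_pair x y) /\
  (forall y, V2 y -> exists! x, V1 x /\ stable_pair x y).

Lemma pair_inj_r x y y' : perfectly_paired -> V1 x -> V2 y -> V2 y' ->
  stable_pair x y -> stable_pair x y' -> y = y'.
Proof.
move=> [V1P _] /V1P[z [_ zu]] y2 y'2 xy xy'.
by rewrite -(zu y)// -(zu y').
Qed.

Lemma pair_inj_l x x' y : perfectly_paired -> V1 x -> V1 x' -> V2 y ->
  stable_pair x y -> stable_pair x' y -> x = x'.
Proof.
move=> [_ V2P] x1 x'1 /V2P[z [_ zu]] xy x'y.
by rewrite -(zu x)// -(zu x').
Qed.

(** The pair [(x, y)] is a closer competitor of [(x, y0)], hence blocked. A blocking pair through
    [x] would be [(x, y0)], which is too long, so the blocking pair goes through [y] and is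
    [(x0, y)]. *)
Lemma paired_stable x y x0 y0 : perfectly_paired ->
  V1 x -> V2 y -> V1 x0 -> V2 y0 -> stable_pair x y0 -> stable_pair x0 y ->
  enorm (x - y) < enorm (x - y0) -> enorm (x0 - y) < enorm (x - y).
Proof.
move=> PP x1 y2 x01 y02 xy0 x0y lt.
have [[y' [y'2 lt' xy']]|[x' [x'1 lt' x'y]]] := stable_pair_blocks_r xy0 y2 lt.
  have y0y' := pair_inj_r PP x1 y02 y'2 xy0 xy'.
  by move: (lt_trans lt' lt); rewrite y0y' ltxx.
by rewrite (pair_inj_l PP x01 x'1 y2 x0y x'y).
Qed.

Lemma paired_stable_l x y x0 y0 : perfectly_paired ->
  V1 x -> V2 y -> V1 x0 -> V2 y0 -> stable_pair x y0 -> stable_pair x0 y ->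
  enorm (x - y) < enorm (x0 - y) -> enorm (x - y0) < enorm (x - y).
Proof.
move=> PP x1 y2 x01 y02 xy0 x0y lt.
have [[y' [y'2 lt' xy']]|[x' [x'1 lt' x'y]]] := stable_pair_blocks_l x0y x1 lt.
  by rewrite (pair_inj_r PP x1 y02 y'2 xy0 xy').
have x0x' := pair_inj_l PP x01 x'1 y2 x0y x'y.
by move: (lt_trans lt' lt); rewrite x0x' ltxx.
Qed.

End relation.

(** * Every stable matching coincides with the stable pairs *)

Section matching_pairs.
Variables (V1 V2 : set E) (M : E -> E -> Prop).
Hypothesis M_r : forall x, V1 x -> exists! y, V2 y /\ M x y.
Hypothesis M_l : forall y, V2 y -> exists! x, V1 x /\ M x y.
Hypothesis M_stable : forall x y x0 y0, V1 x -> V2 y -> V1 x0 -> V2 y0 ->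
  M x y0 -> M x0 y -> enorm (x - y) < enorm (x - y0) ->
  enorm (x - y) < enorm (x0 - y) -> False.
Hypothesis neq_r : forall x y y', V1 x -> V2 y -> V2 y' -> y <> y' ->
  enorm (x - y) <> enorm (x - y').
Hypothesis neq_l : forall x x' y, V1 x -> V1 x' -> V2 y -> x <> x' ->
  enorm (x - y) <> enorm (x' - y).
Hypothesis V1_lf : loc_finite V1.
Hypothesis V2_lf : loc_finite V2.
Hypothesis V_free : chain_free (V1 `|` V2).

Let M_inj_r x y y' : V1 x -> V2 y -> V2 y' -> M x y -> M x y' -> y = y'.
Proof.
by move=> /M_r[z [_ zu]] y2 y'2 xy xy'; rewrite -(zu y)// -(zu y').
Qed.

Let M_inj_l x x' y : V1 x -> V1 x' -> V2 y -> M x y -> M x' y -> x = x'.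
Proof.
by move=> x1 x'1 /M_l[z [_ zu]] xy x'y; rewrite -(zu x)// -(zu x').
Qed.

(** If [(x, y)] is not in [M], stability of [M] and the absence of ties make one of the [M]-pairs at
    [x] and [y] a closer competitor. It would have to be blocked at an earlier stage, by induction
    by another [M]-pair sharing a point with it, which is impossible. *)
Lemma stage_matched n x y : V1 x -> V2 y -> stage V1 V2 n x y -> M x y.
Proof.
elim: n x y => [//|n IH] x y x1 y2 nb; apply: contrapT => nM.
have [y0 [[y02 xy0] _]] := M_r x1; have [x0 [[x01 x0y] _]] := M_l y2.
have yy0 : y <> y0 by move=> yy0; apply: nM; rewrite yy0.
have xx0 : x <> x0 by move=> xx0; apply: nM; rewrite xx0.
have [lt|ge] := ltP (enorm (x - y0)) (enorm (x - y)).
  apply: nb; left; exists y0; split => //.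
  move=> [[y' [y'2 lt' /(IH _ _ x1 y'2) xy']]|[x' [x'1 lt' /(IH _ _ x'1 y02) x'y0]]].
    by move: lt'; rewrite (M_inj_r x1 y02 y'2 xy0 xy') ltxx.
  by move: lt'; rewrite (M_inj_l x1 x'1 y02 xy0 x'y0) ltxx.
have [lt|ge'] := ltP (enorm (x0 - y)) (enorm (x - y)).
  apply: nb; right; exists x0; split => //.
  move=> [[y' [y'2 lt' /(IH _ _ x01 y'2) xy']]|[x' [x'1 lt' /(IH _ _ x'1 y2) x'y0]]].
    by move: lt'; rewrite (M_inj_r x01 y2 y'2 x0y xy') ltxx.
  by move: lt'; rewrite (M_inj_l x01 x'1 y2 x0y x'y0) ltxx.
apply: (M_stable x1 y2 x01 y02 xy0 x0y).
  by rewrite lt_neqAle ge andbT; apply/eqP; exact: neq_r.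
by rewrite lt_neqAle ge' andbT; apply/eqP; exact: neq_l.
Qed.

Let undecided x y := ~ stable_pair V1 V2 x y /\ ~ blocked V1 V2 (stable_pair V1 V2) x y.

(** Otherwise every closer competitor is blocked by a stable pair: it cannot be stable itself, since
    it would block [(x, y)]. There are finitely many competitors, so one stage blocks them all and
    [(x, y)] enters at the next stage. *)
Let undecided_step x y : undecided x y ->
  (exists y', [/\ V2 y', enorm (x - y') < enorm (x - y) & undecided x y']) \/
  (exists x', [/\ V1 x', enorm (x' - y) < enorm (x - y) & undecided x' y]).
Proof.
move=> [nS nB]; apply: contrapT => none; apply: nS.
have [n1 n1P] : exists n, forall y', (V2 `&` [set y' | enorm (x - y') < enorm (x - y)]) y' ->
    blocked V1 V2 (stage V1 V2 n) x y'.
  apply: finite_common_bound.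
  - apply: sub_finite_set (loc_finite_ball x (enorm (x - y)) V2_lf).
    by move=> z [z2 /ltW].
  - by move=> m n a mn; apply: blocked_sub => a' b; exact: stage_le.
  - move=> z [z2 lt]; apply/blocked_stable_pair; apply: contrapT => nb.
    apply: none; left; exists z; split => //; split => // xz.
    by apply: nB; left; exists z.
have [n2 n2P] : exists n, forall x', (V1 `&` [set x' | enorm (x' - y) < enorm (x - y)]) x' ->
    blocked V1 V2 (stage V1 V2 n) x' y.
  apply: finite_common_bound.
  - apply: sub_finite_set (loc_finite_ball y (enorm (x - y)) V1_lf).
    by move=> z [z2 /ltW]; rewrite /= [X in X <= _ -> _]enorm_sym.
  - by move=> m n a mn; apply: blocked_sub => a' b; exact: stage_le.
  - move=> z [z2 lt]; apply/blocked_stable_pair; apply: contrapT => nb.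
    apply: none; right; exists z; split => //; split => // xz.
    by apply: nB; right; exists z.
exists (maxn n1 n2).+1 => -[[z [z2 lt]]|[z [z1 lt]]]; apply.
  by apply: blocked_sub (n1P z (conj z2 lt)) => a b; apply: stage_le; exact: leq_maxl.
by apply: blocked_sub (n2P z (conj z1 lt)) => a b; apply: stage_le; exact: leq_maxr.
Qed.

(** Moving to the nearest undecided partner forces the walk to alternate: the closer undecided pair
    from [undecided_step] cannot contain [u] by minimality, so it contains [v]. The distances
    decrease strictly, which [V_free] forbids. *)
Let walk u v :=
  [/\ V1 u, V2 v, undecided u v &
      forall z, V2 z -> undecided u z -> enorm (u - v) <= enorm (u - z)] \/
  [/\ V2 u, V1 v, undecided v u &
      forall z, V1 z -> undecided z u -> enorm (v - u) <= enorm (z - u)].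

Let start_r u v : V1 u -> V2 v -> undecided u v -> exists w, walk u w /\ enorm (u - w) <= enorm (u - v).
Proof.
move=> u1 v2 uv; have [|r|w [w2 uw] wmin] := @finite_nearest [set z | V2 z /\ undecided u z] u.
- by exists v.
- by apply: sub_finite_set (loc_finite_ball u r V2_lf) => z [[]].
- exists w; split; last exact: wmin.
  by left; split => // z z2 uz; exact: wmin.
Qed.

Let start_l u v : V2 u -> V1 v -> undecided v u -> exists w, walk u w /\ enorm (u - w) <= enorm (u - v).
Proof.
move=> u2 v1 vu; have [|r|w [w1 wu] wmin] := @finite_nearest [set z | V1 z /\ undecided z u] u.
- by exists v.
- by apply: sub_finite_set (loc_finite_ball u r V1_lf) => z [[]].
- exists w; split; last exact: wmin.
  by right; split => // z z2 uz; rewrite enorm_sym [leRHS]enorm_sym; exact: wmin.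
Qed.

Lemma decided x y : V1 x -> V2 y ->
  stable_pair V1 V2 x y \/ blocked V1 V2 (stable_pair V1 V2) x y.
Proof.
move=> x1 y2; apply: contrapT => /not_orP xy.
have [w [xw _]] := start_r x1 y2 xy; apply: (chain_free_walk V_free _ xw) => u v.
case=> [] [u_ v_ uv vmin]; split.
- by left.
- have [[z [z_ lt uz]]|[z [z_ lt uz]]] := undecided_step uv.
    by have := vmin _ z_ uz; rewrite leNgt lt.
  have [w' [vw' le]] := start_l v_ z_ uz; exists w' => //.
  by apply: le_lt_trans le _; rewrite enorm_sym.
- by right.
- have [[z [z_ lt uz]]|[z [z_ lt uz]]] := undecided_step uv; last first.
    by have := vmin _ z_ uz; rewrite leNgt lt.
  have [w' [vw' le]] := start_r v_ z_ uz; exists w' => //.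
  by apply: le_lt_trans le _; rewrite [ltRHS]enorm_sym.
Qed.

(** For the converse, a pair of [M] is decided and cannot be blocked, since the blocking stable pair
    would be a second pair of [M] at the same point. *)
Lemma stable_pair_matched x y : V1 x -> V2 y -> stable_pair V1 V2 x y <-> M x y.
Proof.
move=> x1 y2; split => [[n]|xy]; first exact: stage_matched.
have [//|[[y' [y'2 lt [n xy']]]|[x' [x'1 lt [n x'y]]]]] := decided x1 y2.
  by move: lt; rewrite (M_inj_r x1 y2 y'2 xy (stage_matched x1 y'2 xy')) ltxx.
by move: lt; rewrite (M_inj_l x1 x'1 y2 xy (stage_matched x'1 y2 x'y)) ltxx.
Qed.

Lemma matched_perfectly_paired : perfectly_paired V1 V2.
Proof.
split => [x x1|y y2].
  have [y [[y2 xy] yu]] := M_r x1; exists y; split.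
    by split => //; apply/stable_pair_matched.
  by move=> z [z2 /stable_pair_matched xz]; apply: yu; split => //; exact: xz.
have [x [[x1 xy] xu]] := M_l y2; exists x; split.
  by split => //; apply/stable_pair_matched.
by move=> z [z1 /stable_pair_matched xz]; apply: xu; split => //; exact: xz.
Qed.

End matching_pairs.

(** * Monotonicity of the pairing in the red points *)

Section comparison.
Variables V1 V1' V2 : set E.
Hypothesis V11' : V1 `<=` V1'.
Hypothesis PP : perfectly_paired V1 V2.
Hypothesis PP' : perfectly_paired V1' V2.
Hypothesis V_free : chain_free (V1 `|` V2).

(* If [y] were matched closer by [M] than by [M'], stability of [M'] at the
   M-partner [x] of [y] and then stability of [M] at the M'-partner of [x] give
   an even closer such point, and so on: a descending chain. *)
Lemma more_reds_bring_blues_closer x x' y : V2 y -> V1 x -> V1' x' ->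
  stable_pair V1 V2 x y -> stable_pair V1' V2 x' y ->
  enorm (x' - y) <= enorm (x - y).
Proof.
move=> y2 x1 x'1 xy x'y; rewrite leNgt; apply/negP => lt.
(* The walk leaves blue points along the pairs for [V1] and red points along the pairs for [V1']. In
   both cases the blue end is strictly closer to its partner for [V1] than to its partner for
   [V1']. *)
pose W u v :=
  [/\ V2 u, V1 v, stable_pair V1 V2 v u &
    exists2 z, V1' z & stable_pair V1' V2 z u /\ enorm (v - u) < enorm (z - u)] \/
  [/\ V1 u, V2 v, stable_pair V1' V2 u v &
    exists2 z, V1 z & stable_pair V1 V2 z v /\ enorm (z - v) < enorm (u - v)].
have Wyx : W y x by left; split => //; exists x'.
apply: (chain_free_walk V_free _ Wyx) => u v [] [u_ v_ uv [z z_ [zu zlt]]]; split.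
- by right.
- have [b' [[b'2 vb'] _]] := PP'.1 _ (V11' v_).
  have lt1 : enorm (v - b') < enorm (v - u).
    exact: (paired_stable_l PP' (V11' v_) u_ z_ b'2 vb' zu zlt).
  have [r' [[r'1 r'b'] _]] := PP.2 _ b'2.
  exists b'; last by rewrite [ltRHS]enorm_sym.
  right; split => //; exists r' => //; split => //.
  exact: (paired_stable PP v_ b'2 r'1 u_ uv r'b' lt1).
- by left.
- exists z; last by rewrite enorm_sym.
  by left; split => //; exists u => //; exact: V11'.
Qed.

(** If [x] moved closer to [y'], stability for [V1] would give [y'] an old partner closer than [x];
    but the partner of the blue point [y'] cannot get farther when reds are added. *)
Lemma more_reds_push_reds_away x y y' : V1 x -> V2 y -> V2 y' ->
  stable_pair V1 V2 x y -> stable_pair V1' V2 x y' ->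
  enorm (x - y) <= enorm (x - y').
Proof.
move=> x1 y2 y'2 xy xy'; rewrite leNgt; apply/negP => lt.
have [z [[z1 zy'] _]] := PP.2 _ y'2.
have lt' := paired_stable PP x1 y'2 z1 y2 xy zy' lt.
have := more_reds_bring_blues_closer y'2 z1 (V11' x1) zy' xy'.
by rewrite leNgt lt'.
Qed.

End comparison.

(** * Exchange of colours and translations *)

Section symmetries.
Variables V1 V2 : set E.

Lemma blockedC (S S' : E -> E -> Prop) x y : (forall a b, S a b <-> S' b a) ->
  blocked V1 V2 S x y <-> blocked V2 V1 S' y x.
Proof.
move=> SS'; split => -[[z [z_ lt h]]|[z [z_ lt h]]].
- by right; exists z; split; rewrite ?[enorm (_ - x)]enorm_sym //; apply/SS'.
- by left; exists z; split; rewrite ?[enorm (y - _)]enorm_sym //; apply/SS'.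
- by right; exists z; split; rewrite ?[enorm (_ - y)]enorm_sym //; apply/SS'.
- by left; exists z; split; rewrite ?[enorm (x - _)]enorm_sym //; apply/SS'.
Qed.

Lemma stageC n x y : stage V1 V2 n x y <-> stage V2 V1 n y x.
Proof.
elim: n x y => [//|n IH] x y /=.
by apply: not_iff_compat; apply: blockedC => a b; apply: not_iff_compat; exact: blockedC.
Qed.

Lemma stable_pairC x y : stable_pair V1 V2 x y <-> stable_pair V2 V1 y x.
Proof. by split => -[n /stageC]; exists n. Qed.

Lemma perfectly_pairedC : perfectly_paired V1 V2 -> perfectly_paired V2 V1.
Proof.
move=> [P1 P2]; split => z.
  move=> /P2[w [[w1 wz] wu]]; exists w; split; first by split => //; apply/stable_pairC.
  by move=> v [v1 /stable_pairC vz]; exact: wu.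
move=> /P1[w [[w1 wz] wu]]; exists w; split; first by split => //; apply/stable_pairC.
by move=> v [v1 /stable_pairC vz]; exact: wu.
Qed.

Let shift (t : E) (V : set E) : set E := [set x | V (x - t)].

Lemma blocked_shift t (S S' : E -> E -> Prop) x y :
  (forall a b, S a b <-> S' (a + t) (b + t)) ->
  blocked V1 V2 S x y <-> blocked (shift t V1) (shift t V2) S' (x + t) (y + t).
Proof.
have dE a b : enorm (a + t - (b + t)) = enorm (a - b).
  by rewrite opprD addrACA subrr addr0.
have dE' a b : enorm (a + t - b) = enorm (a - (b - t)).
  by rewrite opprB [t - b]addrC addrA addrAC.
have dE'' a b : enorm (a - (b + t)) = enorm (a - t - b).
  by rewrite opprD addrA addrAC.
move=> SS'; split => -[[z [z_ lt h]]|[z [z_ lt h]]].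
- left; exists (z + t); split; rewrite ?dE//; last exact/SS'.
  by rewrite /shift/= addrK.
- right; exists (z + t); split; rewrite ?dE//; last exact/SS'.
  by rewrite /shift/= addrK.
- left; exists (z - t); split => //; last by apply/SS'; rewrite subrK.
  by move: lt; rewrite dE dE'.
- right; exists (z - t); split => //; last by apply/SS'; rewrite subrK.
  by move: lt; rewrite dE dE''.
Qed.

Lemma stage_shift t n x y : stage V1 V2 n x y <->
  stage (shift t V1) (shift t V2) n (x + t) (y + t).
Proof.
elim: n x y => [//|n IH] x y /=.
by apply: not_iff_compat; apply: blocked_shift => a b; apply: not_iff_compat;
  exact: blocked_shift.
Qed.

Lemma stable_pair_shift t x y : stable_pair V1 V2 x y <->
  stable_pair [set z | V1 (z - t)] [set z | V2 (z - t)] (x + t) (y + t).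
Proof. by split => -[n h]; exists n; exact/(stage_shift t n x y). Qed.

End symmetries.

End stable_pairs.

(** * Measurability of the stable pairing *)

Section measurable_pairs.
Context (R : realType) (d : nat).
Local Notation E := 'rV[R]_d.
Local Notation N := (Measures E R).
Local Notation slf := (simple_lf (@bounded_rV R d)).

Definition mass (mu : N) (A : set E) : \bar R := (regular mu : measures E R) A.

Lemma measurable_mass dT (T : measurableType dT) (f : T -> N) (A : set (T * E))
    (B : set (\bar R)) :
  measurable_fun setT f -> measurable A -> measurable B ->
  measurable [set t | B (mass (f t) [set x | A (t, x)])].
Proof.
move=> mf mA mB; rewrite -[X in measurable X]setTI.
exact: (measurable_regular_section mf mA measurableT mB).
Qed.

Lemma mass_eq0 (mu : N) (A : set E) : slf mu -> measurable A ->
  mass mu A = 0%E <-> forall x, atoms mu x -> ~ A x.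
Proof. by move=> smu mA; rewrite /mass simple_lf_regular//; exact: simple_lf_eq0. Qed.

Lemma mass_neq0 (mu : N) (A : set E) : slf mu -> measurable A ->
  mass mu A <> 0%E <-> exists2 x, atoms mu x & A x.
Proof.
move=> smu mA; rewrite mass_eq0//; split => [nA|[x mux Ax] /(_ x mux)//].
by apply: contrapT => nex; apply: nA => x mux Ax; apply: nex; exists x.
Qed.

Lemma mass_eq1 (mu : N) (A : set E) : slf mu -> measurable A ->
  mass mu A = 1%E <-> exists! x, atoms mu x /\ A x.
Proof. by move=> smu mA; rewrite /mass simple_lf_regular//; exact: simple_lf_eq1. Qed.

(* [mass _ A <> 0] stands for the existence of an atom in [A]. *)
Definition mblocked (S : set (N * N * (E * E))) : set (N * N * (E * E)) :=
  [set t | mass t.1.2 [set y' | enorm (t.2.1 - y') < enorm (t.2.1 - t.2.2) /\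
                                S (t.1, (t.2.1, y'))] <> 0%E] `|`
  [set t | mass t.1.1 [set x' | enorm (x' - t.2.2) < enorm (t.2.1 - t.2.2) /\
                                S (t.1, (x', t.2.2))] <> 0%E].

Lemma measurable_swap_r dT (T : measurableType dT) (S : set (T * (E * E))) :
  measurable S ->
  measurable [set s : T * (E * E) * E |
    enorm (s.1.2.1 - s.2) < enorm (s.1.2.1 - s.1.2.2) /\
    S (s.1.1, (s.1.2.1, s.2))].
Proof.
move=> mS; apply: measurableI.
  apply: measurable_enorm_lt => //; do ?[exact: measurable_snd].
  - by apply: measurableT_comp => //; apply: measurableT_comp.
  - by apply: measurableT_comp => //; apply: measurableT_comp.
  - by apply: measurableT_comp => //; apply: measurableT_comp.
rewrite -[X in measurable X]setTI.
have mg : measurable_fun setT (fun s : T * (E * E) * E => (s.1.1, (s.1.2.1, s.2))).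
  apply: measurable_fun_pair; first exact: measurableT_comp.
  apply: measurable_fun_pair => //.
  by apply: measurableT_comp => //; apply: measurableT_comp.
exact: (mg measurableT _ mS).
Qed.

Lemma measurable_swap_l dT (T : measurableType dT) (S : set (T * (E * E))) :
  measurable S ->
  measurable [set s : T * (E * E) * E |
    enorm (s.2 - s.1.2.2) < enorm (s.1.2.1 - s.1.2.2) /\
    S (s.1.1, (s.2, s.1.2.2))].
Proof.
move=> mS; apply: measurableI.
  apply: measurable_enorm_lt => //; do ?[exact: measurable_snd].
  - by apply: measurableT_comp => //; apply: measurableT_comp.
  - by apply: measurableT_comp => //; apply: measurableT_comp.
  - by apply: measurableT_comp => //; apply: measurableT_comp.
rewrite -[X in measurable X]setTI.
have mg : measurable_fun setT (fun s : T * (E * E) * E => (s.1.1, (s.2, s.1.2.2))).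
  apply: measurable_fun_pair; first exact: measurableT_comp.
  apply: measurable_fun_pair => //.
  by apply: measurableT_comp => //; apply: measurableT_comp.
exact: (mg measurableT _ mS).
Qed.

Lemma measurable_mblocked S : measurable S -> measurable (mblocked S).
Proof.
move=> mS; apply: measurableU.
  apply: (measurable_mass (f := fun t : N * N * (E * E) => t.1.2)
    (B := [set~ 0%E]) _ (measurable_swap_r mS)).
    by apply: measurableT_comp => //; apply: measurableT_comp.
  by apply: measurableC; exact: emeasurable_set1.
apply: (measurable_mass (f := fun t : N * N * (E * E) => t.1.1)
  (B := [set~ 0%E]) _ (measurable_swap_l mS)).
  by apply: measurableT_comp => //; apply: measurableT_comp.
by apply: measurableC; exact: emeasurable_set1.
Qed.

Lemma measurable_section dT dS (T : measurableType dT) (S : measurableType dS)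
  (A : set (T * S)) t : measurable A -> measurable [set x | A (t, x)].
Proof. by move=> mA; have := measurable_xsection t mA; rewrite xsectionE. Qed.

Lemma mblockedP S (mu nu : N) x y (S' : E -> E -> Prop) : slf mu -> slf nu ->
  measurable S -> (forall a b, S (mu, nu, (a, b)) <-> S' a b) ->
  mblocked S (mu, nu, (x, y)) <-> blocked (atoms mu) (atoms nu) S' x y.
Proof.
move=> smu snu mS SS'.
have mr := measurable_section (mu, nu, (x, y)) (measurable_swap_r mS).
have ml := measurable_section (mu, nu, (x, y)) (measurable_swap_l mS).
rewrite /mblocked/=; split.
  case=> /(mass_neq0 _ _)[]// z z_ [zlt /SS' zS]; [left|right]; by exists z.
case=> -[z [z_ zlt /SS' zS]]; [left|right]; apply/mass_neq0 => //; by exists z.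
Qed.

Fixpoint mstage (n : nat) : set (N * N * (E * E)) :=
  if n is n'.+1 then ~` mblocked (~` mblocked (mstage n')) else set0.

Lemma measurable_mstage n : measurable (mstage n).
Proof.
elim: n => [|n IH] /=; first exact: measurable0.
apply: measurableC; apply: measurable_mblocked.
by apply: measurableC; exact: measurable_mblocked.
Qed.

Lemma mstageP n (mu nu : N) x y : slf mu -> slf nu ->
  mstage n (mu, nu, (x, y)) <-> stage (atoms mu) (atoms nu) n x y.
Proof.
move=> smu snu; elim: n x y => [//|n IH] x y.
apply: not_iff_compat; apply: mblockedP => //.
  by apply: measurableC; apply: measurable_mblocked; exact: measurable_mstage.
move=> a b; apply: not_iff_compat; apply: mblockedP => //.
exact: measurable_mstage.
Qed.

Definition mpair : set (N * N * (E * E)) := \bigcup_n mstage n.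

Lemma measurable_mpair : measurable mpair.
Proof. by apply: bigcupT_measurable => n; exact: measurable_mstage. Qed.

Lemma mpairP (mu nu : N) x y : slf mu -> slf nu ->
  mpair (mu, nu, (x, y)) <-> stable_pair (atoms mu) (atoms nu) x y.
Proof.
by move=> smu snu; split => [[n _ h]|[n h]]; exists n => //; exact/mstageP.
Qed.

Definition paired_in (C : set (E * E)) : set (N * N * E) :=
  [set t | mass t.1.2 [set y | mpair (t.1, (t.2, y)) /\ C (t.2, y)] <> 0%E].

Lemma measurable_pairs_in (C : set (E * E)) : measurable C ->
  measurable [set s : N * N * E * E | mpair (s.1.1, (s.1.2, s.2)) /\ C (s.1.2, s.2)].
Proof.
move=> mC; apply: measurableI.
  have mg : measurable_fun setT (fun s : N * N * E * E => (s.1.1, (s.1.2, s.2))).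
    apply: measurable_fun_pair; first exact: measurableT_comp.
    by apply: measurable_fun_pair => //; exact: measurableT_comp.
  by rewrite -[X in measurable X]setTI; exact: (mg measurableT _ measurable_mpair).
have mg : measurable_fun setT (fun s : N * N * E * E => (s.1.2, s.2)).
  by apply: measurable_fun_pair => //; exact: measurableT_comp.
by rewrite -[X in measurable X]setTI; exact: (mg measurableT _ mC).
Qed.

Lemma measurable_paired_in C : measurable C -> measurable (paired_in C).
Proof.
move=> mC.
apply: (measurable_mass (f := fun t : N * N * E => t.1.2)
  (B := [set~ 0%E]) _ (measurable_pairs_in mC)).
  exact: measurableT_comp.
by apply: measurableC; exact: emeasurable_set1.
Qed.

Lemma paired_inP C (mu nu : N) x : measurable C -> slf mu -> slf nu ->
  paired_in C (mu, nu, x) <->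
  exists y, [/\ atoms nu y, stable_pair (atoms mu) (atoms nu) x y & C (x, y)].
Proof.
move=> mC smu snu.
have ms := measurable_section (mu, nu, x) (measurable_pairs_in mC).
rewrite /paired_in/=; split => [/(mass_neq0 snu ms)[y nuy [/mpairP p Cy]]|[y [nuy p Cy]]].
  by exists y; split => //; exact: p.
by apply/(mass_neq0 snu ms); exists y => //; split => //; apply/mpairP.
Qed.

(** The last two conditions express [perfectly_paired] through masses. The first says that red
    charges only points of mass one; it ensures that an inserted point does not fall on an existing
    one. *)
Definition good_pairs : set (N * N) :=
  [set p | mass p.1 [set x | mass p.1 [set x' | x' = x] <> 1%E] = 0%E] `&`
  [set p | mass p.1 [set x | mass p.2 [set y | mpair (p, (x, y))] <> 1%E] = 0%E] `&`
  [set p | mass p.2 [set y | mass p.1 [set x | mpair (p, (x, y))] <> 1%E] = 0%E].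

Lemma measurable_diag : measurable [set t : E * E | t.2 = t.1].
Proof.
rewrite (_ : [set t | _] = [set t : E * E | enorm (t.1 - t.2) <= 0]).
  rewrite -[X in measurable X]setTI.
  have := measurable_fun_ler (measurable_enorm_sub (measurable_fst (T1 := E) (T2 := E)) measurable_snd)
    (measurable_cst (0 : R)).
  by move=> /(_ measurableT [set true]); exact.
apply/seteqP; split => [[x y]/= ->|[x y]/=].
  by rewrite subrr /enorm big1 ?sqrtr0// => i _; rewrite mxE expr0n.
by move=> le; apply: contrapT => /nesym/enorm_gt0; rewrite ltNge le.
Qed.

Lemma measurable_multiple_points :
  measurable [set t : N * N * E | mass t.1.1 [set x' | x' = t.2] <> 1%E].
Proof.
have mA : measurable [set s : N * N * E * E | s.2 = s.1.2].
  have mg : measurable_fun setT (fun s : N * N * E * E => (s.1.2, s.2)).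
    by apply: measurable_fun_pair => //; exact: measurableT_comp.
  by rewrite -[X in measurable X]setTI; exact: (mg measurableT _ measurable_diag).
apply: (measurable_mass (f := fun t : N * N * E => t.1.1) (B := [set~ 1%E]) _ mA).
  exact: measurableT_comp.
by apply: measurableC; exact: emeasurable_set1.
Qed.

Lemma measurable_unpaired_reds :
  measurable [set t : N * N * E | mass t.1.2 [set y | mpair (t.1, (t.2, y))] <> 1%E].
Proof.
have mA : measurable [set s : N * N * E * E | mpair (s.1.1, (s.1.2, s.2))].
  have := measurable_pairs_in measurableT; congr (measurable _).
  by apply/seteqP; split => s; [case|].
apply: (measurable_mass (f := fun t : N * N * E => t.1.2) (B := [set~ 1%E]) _ mA).
  exact: measurableT_comp.
by apply: measurableC; exact: emeasurable_set1.
Qed.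

Lemma measurable_unpaired_blues :
  measurable [set t : N * N * E | mass t.1.1 [set x | mpair (t.1, (x, t.2))] <> 1%E].
Proof.
have mA : measurable [set s : N * N * E * E | mpair (s.1.1, (s.2, s.1.2))].
  have mg : measurable_fun setT (fun s : N * N * E * E => (s.1.1, (s.2, s.1.2))).
    apply: measurable_fun_pair; first exact: measurableT_comp.
    by apply: measurable_fun_pair => //; exact: measurableT_comp.
  by rewrite -[X in measurable X]setTI; exact: (mg measurableT _ measurable_mpair).
apply: (measurable_mass (f := fun t : N * N * E => t.1.1) (B := [set~ 1%E]) _ mA).
  exact: measurableT_comp.
by apply: measurableC; exact: emeasurable_set1.
Qed.

Lemma measurable_good_pairs : measurable good_pairs.
Proof.
apply: measurableI; first apply: measurableI.
- apply: (measurable_mass (f := fun p : N * N => p.1) (B := [set 0%E])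
    measurable_fst measurable_multiple_points); exact: emeasurable_set1.
- apply: (measurable_mass (f := fun p : N * N => p.1) (B := [set 0%E])
    measurable_fst measurable_unpaired_reds); exact: emeasurable_set1.
- apply: (measurable_mass (f := fun p : N * N => p.2) (B := [set 0%E])
    measurable_snd measurable_unpaired_blues); exact: emeasurable_set1.
Qed.

Lemma good_pairsP (mu nu : N) : slf mu -> slf nu ->
  good_pairs (mu, nu) <-> perfectly_paired (atoms mu) (atoms nu).
Proof.
move=> smu snu.
have m1 := measurable_section (mu, nu) measurable_multiple_points.
have m2 := measurable_section (mu, nu) measurable_unpaired_reds.
have m3 := measurable_section (mu, nu) measurable_unpaired_blues.
have mr x : measurable [set y | mpair (mu, nu, (x, y))].
  have := measurable_section (mu, nu, x) (measurable_pairs_in measurableT).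
  by congr (measurable _); apply/seteqP; split => s; [case|].
have ml y : measurable [set x | mpair (mu, nu, (x, y))].
  have mg : measurable_fun setT (fun x : E => ((mu, nu), (x, y))).
    by apply: measurable_fun_pair => //; apply: measurable_fun_pair.
  by rewrite -[X in measurable X]setTI; exact: (mg measurableT _ measurable_mpair).
have eqP1 x : mass nu [set y | mpair (mu, nu, (x, y))] = 1%E <->
    exists! y, atoms nu y /\ stable_pair (atoms mu) (atoms nu) x y.
  rewrite mass_eq1//; split => -[y [[nuy p] yu]]; exists y; split.
  - by split => //; apply/mpairP.
  - by move=> z [nuz /mpairP pz]; apply: yu; split => //; exact: pz.
  - by split => //; apply/mpairP.
  - by move=> z [nuz /mpairP pz]; apply: yu; split => //; exact: pz.
have eqP2 y : mass mu [set x | mpair (mu, nu, (x, y))] = 1%E <->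
    exists! x, atoms mu x /\ stable_pair (atoms mu) (atoms nu) x y.
  rewrite mass_eq1//; split => -[x [[mux p] xu]]; exists x; split.
  - by split => //; apply/mpairP.
  - by move=> z [nuz /mpairP pz]; apply: xu; split => //; exact: pz.
  - by split => //; apply/mpairP.
  - by move=> z [nuz /mpairP pz]; apply: xu; split => //; exact: pz.
split.
  move=> [[_ /(mass_eq0 smu m2)/= h2] /(mass_eq0 snu m3)/= h3]; split.
    by move=> x /h2 /contrapT/eqP1.
  by move=> y /h3 /contrapT/eqP2.
move=> [h2 h3]; split; first split.
- apply/(mass_eq0 smu m1) => x mux /=; apply.
  by rewrite /mass simple_lf_regular.
- by apply/(mass_eq0 smu m2) => x /h2/eqP1 /= ->.
- by apply/(mass_eq0 snu m3) => x /h3/eqP2 /= ->.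
Qed.

(** A point inserted on an atom gets mass two, so it belongs to the set that [good_pairs] requires
    to be null, although the new measure charges it. *)
Lemma good_pairs_add_point (mu nu : N) (u : E) : slf mu ->
  good_pairs (add_point mu u, nu) -> ~ atoms mu u.
Proof.
move=> smu [[/= h _] _] muu.
have cf : cube_finite (add_point mu u).
  move=> n; rewrite add_pointE; apply: lte_add_pinfty.
    exact: simple_lf_cube_finite.
  by rewrite diracE ltry.
move: h; rewrite /mass regularE//.
have m1 := measurable_section (add_point mu u, mu) measurable_multiple_points.
move=> h.
have : (\d_u [set x | mass (add_point mu u) [set x' | x' = x] <> 1] <= 0 :> \bar R)%E.
  rewrite -h /mass regularE// add_pointE leeDr//.
rewrite diracE mem_set/= ?lee_fin ?ler10//.
rewrite /mass regularE// add_pointE (_ : [set x' | x' = u] = [set u])//.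
rewrite (_ : (mu : measures E R) [set u] = 1%E)// diracE mem_set//.
by move=> [] /eqP; rewrite -subr_eq0 addrK oner_eq0.
Qed.

End measurable_pairs.

(** * A single sample of the given stable matching *)

Section matching_configuration.
Context (R : realType) (d : nat).
Local Notation E := 'rV[R]_d.
Local Notation N := (Measures E R).
Local Notation slf := (simple_lf (@bounded_rV R d)).

Lemma upair_eq dT (T : measurableType dT) (e e' : upair T) : sval e = sval e' -> e = e'.
Proof.
case: e e' => [e He] [e' He'] /= ee'; move: He; rewrite ee' => He.
by congr exist; exact: Prop_irrelevance.
Qed.

Lemma mk_upairC dT (T : measurableType dT) (x y : T) : mk_upair x y = mk_upair y x.
Proof. by apply: upair_eq; rewrite /= setUC. Qed.

Lemma mk_upair_inj_r dT (T : measurableType dT) (x y z : T) :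
  mk_upair x y = mk_upair x z -> y = z.
Proof.
move=> /(congr1 sval)/= xyz.
have : [set x; z] y by rewrite -xyz; right.
have : [set x; y] z by rewrite xyz; right.
by move=> [] -> [].
Qed.

Variables (mu nu : N) (m : Measures (Upair E) R).
Hypothesis smu : slf mu.
Hypothesis snu : slf nu.
Hypothesis m_perfect :
  perfect_bipartite_matching (atoms mu) (atoms nu) (atoms m).
Hypothesis m_stable : ~ exists x y,
    [/\ atoms mu x, atoms nu y &
        enorm (x - y) < Num.min (enorm (x - partner m x)) (enorm (y - partner m y))].
Hypothesis m_neq : non_equidistant (madd mu nu).
Hypothesis m_nochain : ~ descending_chain (madd mu nu).

Let M x y := atoms m (mk_upair x y : upair E).

Let disj x : atoms mu x -> atoms nu x -> False.
Proof.
move=> mux nux; have [m0 _ _] := m_perfect.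
by have : (atoms mu `&` atoms nu) x by []; rewrite m0.
Qed.

Let not_atom (mu' : N) x : slf mu' -> ~ atoms mu' x -> (mu' : measures E R) [set x] = 0%E.
Proof.
move=> smu' nx; apply/(simple_lf_eq0 smu'); first exact: measurable_mx_set1.
by move=> z muz /= zx; apply: nx; rewrite -zx.
Qed.

(** Perfectness makes the colour classes disjoint, so an atom of either colour has mass exactly one
    in the sum, and the hypotheses on the sum apply to it. *)
Let atoms_sum x : (atoms mu `|` atoms nu) x -> atoms (madd mu nu) x.
Proof.
move=> xV; rewrite /atoms/=.
have -> : (madd mu nu : measures E R) [set x] =
    ((mu : measures E R) [set x] + (nu : measures E R) [set x])%E by exact: measure_addE.
case: xV => xV.
  by rewrite xV not_atom ?adde0// => /disj; exact.
by rewrite (not_atom smu) ?add0e// => /disj; exact.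
Qed.

Lemma chain_free_atoms : chain_free (atoms mu `|` atoms nu).
Proof.
move=> [s [sV lt]]; apply: m_nochain; exists s; split => // i.
by apply: atoms_sum; exact: sV.
Qed.

Let edge_unique x e e' : (atoms mu `|` atoms nu) x ->
  atoms m e -> atoms m e' -> incident x e -> incident x e' -> e = e'.
Proof.
have [_ _ m1] := m_perfect; move=> /m1[f [_ fu]] me me' xe xe'.
by rewrite -(fu e)// -(fu e').
Qed.

Lemma partner_eq x y : (atoms mu `|` atoms nu) x -> M x y -> partner m x = y.
Proof.
move=> xV Mxy; rewrite /partner; case: xgetP => [z _ /= Mxz|/(_ y)//].
apply: (@mk_upair_inj_r _ _ x); apply: edge_unique xV _ _ _ _ => //; by left.
Qed.

Let M_r x : atoms mu x -> exists! y, atoms nu y /\ M x y.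
Proof.
move=> mux; have [_ m1 m2] := m_perfect.
have [e [[me xe] _]] := m2 x (or_introl mux).
have [a [b [mua nub eab]]] := m1 _ me.
have xa : x = a by move: xe; rewrite eab => -[//|xb]; exfalso; move: nub; rewrite -xb; exact: disj.
exists b; split; first by split => //; rewrite /M xa -eab.
move=> z [_ Mxz]; have Mxb : M x b by rewrite /M xa -eab.
by rewrite -(partner_eq (or_introl mux) Mxb); exact: partner_eq (or_introl mux) Mxz.
Qed.

Let M_l y : atoms nu y -> exists! x, atoms mu x /\ M x y.
Proof.
move=> nuy; have [_ m1 m2] := m_perfect.
have [e [[me ye] _]] := m2 y (or_intror nuy).
have [a [b [mua nub eab]]] := m1 _ me.
have yb : y = b by move: ye; rewrite eab => -[ya|//]; exfalso; move: mua; rewrite -ya => /disj; exact.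
exists a; split; first by split => //; rewrite /M yb -eab.
have MC z : M z y -> M y z by rewrite /M mk_upairC.
have Mab : M a y by rewrite /M yb -eab.
move=> z [_ /MC Myz].
by rewrite -(partner_eq (or_intror nuy) (MC _ Mab)); exact: partner_eq (or_intror nuy) Myz.
Qed.

Let M_stable x y x0 y0 : atoms mu x -> atoms nu y -> atoms mu x0 -> atoms nu y0 ->
  M x y0 -> M x0 y -> enorm (x - y) < enorm (x - y0) ->
  enorm (x - y) < enorm (x0 - y) -> False.
Proof.
move=> mux nuy mux0 nuy0 xy0 x0y lt lt'; apply: m_stable; exists x, y; split => //.
rewrite (partner_eq (or_introl mux) xy0) (@partner_eq y x0 (or_intror nuy)).
  by rewrite lt_min lt [enorm (y - x0)]enorm_sym.
by rewrite /M mk_upairC.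
Qed.

Let neq_r x y y' : atoms mu x -> atoms nu y -> atoms nu y' -> y <> y' ->
  enorm (x - y) <> enorm (x - y').
Proof.
move=> mux nuy nuy' yy'; apply: m_neq; do ?[by apply: atoms_sum; (left + right)].
  move=> xy; have : [set x; y'] y by rewrite -xy; right.
  by move=> [yx|//]; apply: (@disj x) => //; rewrite -yx.
by move=> xy; apply: (@disj x) => //; rewrite xy.
Qed.

Let neq_l x x' y : atoms mu x -> atoms mu x' -> atoms nu y -> x <> x' ->
  enorm (x - y) <> enorm (x' - y).
Proof.
move=> mux mux' nuy xx'; apply: m_neq; do ?[by apply: atoms_sum; (left + right)].
  move=> xy; have : [set x'; y] x by rewrite -xy; left.
  by move=> [//|xy']; apply: (@disj x) => //; rewrite xy'.
by move=> xy; apply: (@disj x) => //; rewrite xy.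
Qed.

Lemma perfectly_paired_atoms : perfectly_paired (atoms mu) (atoms nu).
Proof.
exact: (matched_perfectly_paired M_r M_l M_stable neq_r neq_l
  (simple_lfP smu).1 (simple_lfP snu).1 chain_free_atoms).
Qed.

Lemma stable_pair_partner x y : atoms mu x -> atoms nu y ->
  stable_pair (atoms mu) (atoms nu) x y -> partner m x = y.
Proof.
move=> mux nuy xy; apply: partner_eq; first by left.
exact/(stable_pair_matched M_r M_l M_stable neq_r neq_l
  (simple_lfP smu).1 (simple_lfP snu).1 chain_free_atoms).
Qed.

Lemma stable_pair_dist_gt0 x y : atoms mu x -> atoms nu y -> 0 < enorm (x - y).
Proof.
by move=> mux nuy; apply: enorm_gt0 => xy; apply: (@disj x) => //; rewrite xy.
Qed.

End matching_configuration.

(** * Joint laws of independent random elements *)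

Section null_sections.
Local Open Scope ereal_scope.
Context d1 d2 (T1 : measurableType d1) (T2 : measurableType d2) (R : realType).
Variables (Q1 : probability T1 R) (Q2 : probability T2 R).

Lemma integral_eq0_iff d (T : measurableType d) (mu : {measure set T -> \bar R})
    (f : T -> \bar R) : measurable_fun setT f -> (forall x, 0 <= f x) ->
  \int[mu]_x f x = 0 <-> mu [set x | f x <> 0] = 0.
Proof.
move=> mf f0.
have mf0 : measurable [set x | f x <> 0].
  rewrite -[X in measurable X]setTI.
  by apply: (mf measurableT [set~ 0]); apply: measurableC; exact: emeasurable_set1.
have -> : \int[mu]_x f x = \int[mu]_x `|f x|.
  by apply: eq_integral => x _; rewrite gee0_abs.
have ae := ae_eq_integral_abs mu measurableT mf.
split => [/ae|f0'].
  move=> ae0; apply/negligibleP => //; move: ae0; apply: negligibleS.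
  by move=> x /= nf0 h; apply: nf0; exact: h.
apply/ae; apply: (@negligibleS _ _ _ _ [set x | f x <> 0]); last exact/negligibleP.
by move=> x /= h h'; apply: h => _.
Qed.

Lemma product_null (C : set (T1 * T2)) : measurable C ->
  (Q1 \x Q2) C = 0 <-> Q1 [set x | Q2 [set y | C (x, y)] <> 0] = 0.
Proof.
move=> mC; rewrite /product_measure1/= integral_eq0_iff//=.
  by under eq_set do rewrite xsectionE.
exact: measurable_fun_xsection.
Qed.

(** Both sides say that [C] is null for the product measure. *)
Lemma null_sectionsC (C : set (T1 * T2)) : measurable C ->
  Q1 [set x | Q2 [set y | C (x, y)] <> 0] = 0 <->
  Q2 [set y | Q1 [set x | C (x, y)] <> 0] = 0.
Proof.
move=> mC; rewrite -product_null//.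
have -> : (Q1 \x Q2) C = (Q1 \x^ Q2) C.
  by apply: product_measure_unique => //= *; rewrite product_measure2E.
rewrite /product_measure2/= integral_eq0_iff//=.
  by under eq_set do rewrite ysectionE.
exact: measurable_fun_ysection.
Qed.

Lemma measurable_null_section (C : set (T1 * T2)) : measurable C ->
  measurable [set x | Q2 [set y | C (x, y)] <> 0].
Proof.
move=> mC; rewrite -[X in measurable X]setTI.
have := measurable_fun_xsection Q2 mC => /(_ measurableT [set~ 0]).
rewrite (_ : _ @^-1` _ = [set x | Q2 [set y | C (x, y)] <> 0]).
  by apply; apply: measurableC; exact: emeasurable_set1.
by apply/seteqP; split => x /=; rewrite xsectionE.
Qed.

Lemma measurable_null_sectionC (C : set (T1 * T2)) : measurable C ->
  measurable [set y | Q1 [set x | C (x, y)] <> 0].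
Proof.
move=> mC; rewrite -[X in measurable X]setTI.
have := measurable_fun_ysection Q1 mC => /(_ measurableT [set~ 0]).
rewrite (_ : _ @^-1` _ = [set y | Q1 [set x | C (x, y)] <> 0]).
  by apply; apply: measurableC; exact: emeasurable_set1.
by apply/seteqP; split => x /=; rewrite ysectionE.
Qed.

End null_sections.

Section pair_laws.
Local Open Scope ereal_scope.
Context d (Omega : measurableType d) (R : realType) (P : probability Omega R).
Context d1 d2 (S1 : measurableType d1) (S2 : measurableType d2).
Variables (X : Omega -> S1) (Y : Omega -> S2).
Hypotheses (mX : measurable_fun setT X) (mY : measurable_fun setT Y).
Hypothesis XY : indep_rv P X Y.

Let X' : {mfun Omega >-> S1} := HB.pack X (isMeasurableFun.Build _ _ _ _ X mX).
Let Y' : {mfun Omega >-> S2} := HB.pack Y (isMeasurableFun.Build _ _ _ _ Y mY).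
Let Q1 : probability S1 R := distribution P X'.
Let Q2 : probability S2 R := distribution P Y'.

(** The two laws agree on rectangles. The pair [V], [W] is kept apart from [X], [Y] so that the
    translated processes can be inserted. *)
Lemma joint_law (V : Omega -> S1) (W : Omega -> S2) :
  measurable_fun setT V -> measurable_fun setT W -> indep_rv P V W ->
  same_law P V P X -> same_law P W P Y ->
  forall C, measurable C -> P [set w | C (V w, W w)] = (Q1 \x Q2) C.
Proof.
move=> mV mW VW VX WY C mC.
have mVW : measurable_fun setT (fun w => (V w, W w)) by exact: measurable_fun_pair.
rewrite (@product_measure_unique _ _ _ _ _ Q1 Q2 (pushforward P (fun w => (V w, W w))))// => A B mA mB.
rewrite [LHS]VW// VX// WY//.
Qed.

Lemma joint_integral (V : Omega -> S1) (W : Omega -> S2) :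
  measurable_fun setT V -> measurable_fun setT W -> indep_rv P V W ->
  same_law P V P X -> same_law P W P Y ->
  forall g : S1 * S2 -> \bar R, measurable_fun setT g -> (forall p, 0 <= g p) ->
  \int[P]_w g (V w, W w) = \int[P]_w g (X w, Y w).
Proof.
move=> mV mW VW VX WY g mg g0.
have mVW : measurable_fun setT (fun w => (V w, W w)) by exact: measurable_fun_pair.
have mXY : measurable_fun setT (fun w => (X w, Y w)) by exact: measurable_fun_pair.
rewrite -(ge0_integral_pushforward mVW P measurableT mg)//.
rewrite -(ge0_integral_pushforward mXY P measurableT mg)//.
apply: eq_measure_integral => C mC _.
by rewrite [LHS]joint_law// [RHS]joint_law.
Qed.

(** By Fubini, the first coordinates whose section is not null form a null event for [X] alone.
    Domination applies to that event, and Fubini puts the second coordinate back. *)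
Lemma null_preserving_fst (T : S1 -> S1) : measurable_fun setT T ->
  law_dominated P (T \o X) P X ->
  forall C, measurable C -> P [set w | C (X w, Y w)] = 0 ->
    P [set w | C (T (X w), Y w)] = 0.
Proof.
move=> mT TX C mC.
have mC' : measurable [set p : S1 * S2 | C (T p.1, p.2)].
  have mg : measurable_fun setT (fun p : S1 * S2 => (T p.1, p.2)).
    by apply: measurable_fun_pair => //; exact: measurableT_comp.
  by rewrite -[X in measurable X]setTI; exact: (mg measurableT _ mC).
rewrite joint_law//.
have := @joint_law X Y mX mY XY (fun _ _ => erefl) (fun _ _ => erefl) _ mC'.
move=> -> /(product_null _ _ mC) => h; apply/product_null => //=.
exact: (TX _ (measurable_null_section Q2 mC) h).
Qed.

(** The same argument with an auxiliary random [u]. The order of integration is exchanged so that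
    [u] is fixed when the independence of [X] and [Y] is used. *)
Lemma null_preserving_random_fst dU (U : measurableType dU)
    (rho : probability U R) (K : S1 * U -> S1) : measurable_fun setT K ->
  (forall A, measurable A -> P (X @^-1` A) = 0 ->
     (P \x rho) [set wu | A (K (X wu.1, wu.2))] = 0) ->
  forall C, measurable C -> P [set w | C (X w, Y w)] = 0 ->
    P [set w | rho [set u | C (K (X w, u), Y w)] <> 0] = 0.
Proof.
move=> mK KX C mC PC0.
have mXU : measurable_fun setT (fun wu : Omega * U => K (X wu.1, wu.2)).
  apply: (measurableT_comp mK); apply: measurable_fun_pair => //.
  exact: measurableT_comp.
have mCU : measurable [set wu : Omega * U | C (K (X wu.1, wu.2), Y wu.1)].
  have mg : measurable_fun setT (fun wu : Omega * U => (K (X wu.1, wu.2), Y wu.1)).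
    by apply: measurable_fun_pair => //; exact: measurableT_comp.
  by rewrite -[X in measurable X]setTI; exact: (mg measurableT _ mC).
apply/(null_sectionsC P rho mCU).
pose A := [set x | Q2 [set y | C (x, y)] <> 0].
have mA : measurable A := measurable_null_section Q2 mC.
have XA0 : P (X @^-1` A) = 0.
  by move: PC0; rewrite joint_law// => /(product_null _ _ mC).
have mAU : measurable [set wu : Omega * U | A (K (X wu.1, wu.2))].
  by rewrite -[X in measurable X]setTI; exact: (mXU measurableT _ mA).
have := KX A mA XA0; move=> /(product_null _ _ mAU)/(null_sectionsC P rho mAU).
apply: subset_measure0.
- exact: (measurable_null_sectionC P mCU).
- exact: (measurable_null_sectionC P mAU).
move=> u /= + h0; apply.
have mKu : measurable_fun setT (fun x => K (x, u)).
  by apply: (measurableT_comp mK); exact: measurable_fun_pair.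
have mCu : measurable [set p : S1 * S2 | C (K (p.1, u), p.2)].
  have mg : measurable_fun setT (fun p : S1 * S2 => (K (p.1, u), p.2)).
    by apply: measurable_fun_pair => //; exact: (measurableT_comp mKu).
  by rewrite -[X in measurable X]setTI; exact: (mg measurableT _ mC).
have := @joint_law X Y mX mY XY (fun _ _ => erefl) (fun _ _ => erefl) _ mCu.
move=> /= ->; apply/product_null => //=; exact: h0.
Qed.

End pair_laws.

(** * The moment bound *)

Section lattice_moment.
Context (R : realType) (d : nat).

Definition lattice_norm (z : 'rV[int]_d) : R := `|map_mx (fun k : int => k%:~R) z : 'rV[R]_d|.

Lemma lattice_coord_le (z : 'rV[int]_d) i : `|(z 0 i)%:~R : R| <= lattice_norm z.
Proof. by have := coord_le_norm (map_mx (fun k : int => k%:~R) z : 'rV[R]_d) i; rewrite mxE. Qed.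

(** Shifting coordinates by [k], the integer part of [y], injects the lattice points of norm below
    [y] into a grid with [2 k + 1] values per coordinate. *)
Lemma sum_lattice_le (y : R) : 0 <= y ->
  (\sum_(n <oo) (if pickle_inv n is Some z then (lattice_norm z < y)%R%:R else 0)%:E
    <= ((2 * y + 1) ^+ d)%:E)%E.
Proof.
move=> y0; apply: lime_le.
  by apply: is_cvg_nneseries => n _ _; rewrite lee_fin; case: pickle_inv.
apply: nearW => N; rewrite sumEFin lee_fin big_mkord.
pose k := Num.trunc y.
have ky : k%:R <= y by rewrite -truncn_ge_nat.
pose a (i : 'I_N) : bool := if pickle_inv i is Some z then (lattice_norm z < y)%R else false.
have aE (i : 'I_N) : (if pickle_inv i is Some z then (lattice_norm z < y)%R%:R else 0) = (a i)%:R :> R.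
  by rewrite /a; case: pickle_inv.
rewrite (eq_bigr _ (fun i _ => aE i)) -natr_sum.
have -> : (\sum_(i < N) a i = #|[set i | a i]%SET|)%N.
  by rewrite -sum1dep_card [RHS]big_mkcond; apply: eq_bigr => i _; case: (a i).
pose f (i : 'I_N) : {ffun 'I_d -> 'I_(2 * k).+1} :=
  [ffun j => if pickle_inv i is Some z then inord (absz ((z : 'rV[int]_d) 0 j + k%:Z)) else ord0].
have zk (z : 'rV[int]_d) j : lattice_norm z < y -> (- k%:Z <= z 0 j <= k%:Z)%R.
  move=> zy; have := le_trans (lattice_coord_le z j) (ltW zy).
  rewrite -intr_norm -natr_absz -truncn_ge_nat// -/k => h; lia.
have absz_inj (u v : int) : (- k%:Z <= v <= k%:Z)%R -> (- k%:Z <= u <= k%:Z)%R ->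
  absz (u + k%:Z) = absz (v + k%:Z) -> u = v by lia.
have finj : {in [set i | a i]%SET &, injective f}.
  move=> i j; rewrite !inE /a => ai aj /ffunP fij.
  apply: ord_inj; have := @pickle_invK 'rV[int]_d i; have := @pickle_invK 'rV[int]_d j.
  move: ai aj fij; rewrite /f.
  case: (pickle_inv i) => [z|//]; case: (pickle_inv j) => [z'|//] zy z'y fij; rewrite /oapp => jE iE.
  rewrite -iE -jE.
  suff -> : z = z' by [].
  apply/rowP => l; have := fij l; rewrite !ffunE => /(congr1 (@nat_of_ord _)).
  have := zk z l zy; have := zk z' l z'y.
  move=> h h'; rewrite !inordK; [|lia|lia]; exact: absz_inj.
rewrite -(card_in_imset finj).
have : (#|f @: [set i | a i]%SET| <= (2 * k).+1 ^ d)%N.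
  by apply: leq_trans (max_card _) _; rewrite card_ffun !card_ord.
rewrite -(ler_nat R) => /le_trans; apply; rewrite natrX; apply: lerXn2r.
- by rewrite nnegrE.
- by rewrite nnegrE; lra.
- by rewrite -natr1 natrM lerD2r ler_pM2l.
Qed.

(** The sum is the expected number of lattice points of norm below [4 X + b], a count of order
    [X ^+ d]. *)
Lemma lattice_moment dQ (Om : measurableType dQ) (Q : probability Om R)
    (X : {RV Q >-> R}) (b : R) : 0 <= b -> Q [set w | X w <= 0] = 0%E ->
  ('E_Q[fun w => (X w ^+ d)%R] <> +oo)%E ->
  (\sum_(n <oo) (if pickle_inv n is Some z
                 then Q [set w | ((lattice_norm z - b) / 4 < X w)%R] else 0) < +oo)%E.
Proof.
move=> b0 X0 EX.
have mX : measurable_fun setT X by exact: measurable_funP.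
pose f n w : \bar R :=
  (if pickle_inv n is Some z then (lattice_norm z < 4 * X w + b)%R%:R else 0)%:E.
have f_ge0 n w : (0 <= f n w)%E by rewrite /f lee_fin; case: pickle_inv.
have mA z : measurable [set w | ((lattice_norm z - b) / 4 < X w)%R].
  rewrite -[X in measurable X]setTI.
  have := measurable_fun_ltr (measurable_cst ((lattice_norm z - b) / 4)) mX.
  by move=> /(_ measurableT [set true]); apply.
have fE n z : pickle_inv n = Some z ->
    f n = EFin \o \1_[set w | ((lattice_norm z - b) / 4 < X w)%R].
  move=> nz; apply/funext => w; rewrite /f nz /= indicE; congr ((nat_of_bool _)%:R%:E).
  apply/idP/idP => [h|]; first by rewrite inE /=; lra.
  by rewrite inE /= => h; lra.
have mf n : measurable_fun setT (f n).
  case nz : (pickle_inv n) => [z|].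
    rewrite (fE _ _ nz); apply/measurable_EFinP; exact: measurable_indic.
  rewrite (_ : f n = cst 0%E) ?measurable_cst//.
  by apply/funext => w; rewrite /f nz.
have termE n : (if pickle_inv n is Some z
      then Q [set w | ((lattice_norm z - b) / 4 < X w)%R] else 0)%E = (\int[Q]_w f n w)%E.
  case nz : (pickle_inv n) => [z|].
    by rewrite (fE _ _ nz) integral_indic// setIT.
  by rewrite integral0_eq// => w _; rewrite /f nz.
under eq_eseriesr do rewrite termE.
rewrite -integral_nneseries//.
have mXd : measurable_fun setT (fun w => `|X w ^+ d|).
  by apply: measurableT_comp => //; exact: measurable_funX.
have mg : measurable_fun setT (fun w => 1 + (`|X w ^+ d|)%:E)%E.
  by apply: emeasurable_funD; [exact: measurable_cst|exact/measurable_EFinP].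
(* The base of the counting bound is [2 (4 X + b) + 1]. It is at most [9 + 2 b] when [|X| <= 1] and
   at most [(9 + 2 b) |X|] when [|X| > 1]. *)
pose K := (9 + 2 * b) ^+ d.
have K0 : 0 <= K by apply: exprn_ge0; lra.
apply: (@le_lt_trans _ _ (\int[Q]_w (K%:E * (1 + (`|X w ^+ d|)%:E))%E)%E).
  apply: ge0_le_integral => //.
  - by move=> w _; apply: nneseries_ge0.
  - by apply: ge0_emeasurable_sum.
  - exact: (measurable_funeM K%:E mg).
  - move=> w _; have [y0|y0] := leP 0 (4 * X w + b).
      apply: (le_trans (sum_lattice_le y0)).
      rewrite -EFinD -EFinM lee_fin normrX -[1]addr0.
      have [X1|X1] := leP `|X w| 1.
        apply: (@le_trans _ _ (K * 1)); last first.
          by rewrite ler_wpM2l// addr0 lerDl exprn_ge0.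
        rewrite mulr1 /K lerXn2r// ?nnegrE; [lra|lra|].
        have := ler_norm (X w); lra.
      apply: (@le_trans _ _ (K * `|X w| ^+ d)); last first.
        by rewrite ler_wpM2l// addr0 lerDr.
      rewrite /K -exprMn lerXn2r// ?nnegrE; [lra|apply: mulr_ge0; lra|].
      have := ler_norm (X w) => hX; rewrite addr0.
      have : 0 <= (1 + 2 * b) * (`|X w| - 1) by apply: mulr_ge0; lra.
      lra.
    rewrite eseries0 => [|n _ _].
      by rewrite -EFinD -EFinM lee_fin mulr_ge0// addr_ge0.
    rewrite /f; case: pickle_inv => [z|//].
    by rewrite ltNge (le_trans (ltW y0))// normr_ge0.
rewrite ge0_integralZl//; first last.
  - by move=> w _; rewrite -EFinD lee_fin addr_ge0.
rewrite ge0_integralD//; last exact/measurable_EFinP.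
rewrite integral_cst// mul1e [X in (X + _)%E]probability_setT.
apply: lte_mul_pinfty => //; rewrite ?lee_fin//.
apply: lte_add_pinfty; first by rewrite ltry.
have -> : (\int[Q]_w (`|X w ^+ d|)%:E = 'E_Q[fun w => (X w ^+ d)%R])%E.
  rewrite unlock; apply: ae_eq_integral => //.
  - exact/measurable_EFinP.
  - by apply/measurable_EFinP; exact: measurable_funX.
  exists [set w | X w <= 0]; split => //.
    rewrite -[X in measurable X]setTI.
    have := measurable_fun_ler mX (measurable_cst (0 : R)).
    by move=> /(_ measurableT [set true]); apply.
  move=> w /= h; rewrite leNgt; apply/negP => Xw; apply: h => _.
  by rewrite ger0_norm// exprn_ge0// ltW.
by rewrite ltey; apply/eqP.
Qed.

End lattice_moment.

(** * Counts of near and far pairs, and their translation invariance *)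

Section far_pairs.
Context (R : realType) (d : nat).
Local Notation E := 'rV[R]_d.
Local Notation N := (Measures E R).
Local Notation slf := (simple_lf (@bounded_rV R d)).

Lemma measurable_translate (y : E) : measurable_fun setT (@translate R d y).
Proof.
apply: measurable_Measures => A mA; apply: (measurable_eval (T := E)).
by rewrite -[X in measurable X]setTI; exact: measurable_mx_shift.
Qed.

Definition paired_count (A : set E) (C : set (E * E)) (p : N * N) : \bar R :=
  mass p.1 (A `&` [set x | paired_in C (p, x)]).

Lemma measurable_paired_count A C : measurable A -> measurable C ->
  measurable_fun setT (paired_count A C).
Proof.
move=> mA mC.
have mS : measurable [set t : N * N * E | A t.2 /\ paired_in C (t.1, t.2)].
  apply: measurableI.
    by rewrite -[X in measurable X]setTI; exact: (measurable_snd measurableT _ mA).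
  rewrite [X in measurable X](_ : _ = paired_in C); first exact: measurable_paired_in.
  by apply/seteqP; split => -[[]].
exact: (measurable_regular_section (measurable_fst (T1 := N) (T2 := N)) mS).
Qed.

Lemma measurable_paired_section A C (p : N * N) : measurable A -> measurable C ->
  measurable (A `&` [set x | paired_in C (p, x)]).
Proof.
by move=> mA mC; apply: measurableI => //; apply: measurable_section; exact: measurable_paired_in.
Qed.

Lemma paired_count_translate (z : 'rV[int]_d) (C : set (E * E)) (mu nu : N) :
  measurable C -> (forall t x y, C (x, y) -> C (x + t, y + t)) ->
  slf mu -> slf nu ->
  let t := - (map_mx (fun k : int => k%:~R) z : E) in
  paired_count (int_cube z) C (mu, nu) =
  paired_count (int_cube 0) C (translate t mu, translate t nu).
Proof.
move=> mC Ct smu snu t.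
have [smu' amu] := atoms_translate t smu; have [snu' anu] := atoms_translate t snu.
rewrite /paired_count/= /mass !simple_lf_regular// /translate/= /shifted /pushforward.
congr ((mu : measures E R) _); apply/seteqP; split => x /=.
  move=> [zx /(paired_inP _ mC smu snu)[y [nuy xy Cxy]]]; split.
    move=> i; have := zx i; rewrite /t !mxE mulr0z; move: (x 0 i) (_%:~R) => a b.
    by move=> /andP[? ?]; apply/andP; split; lra.
  apply/paired_inP => //; exists (y + t); split; last exact: Ct.
    by rewrite anu /= addrK.
  by rewrite amu anu; exact: (stable_pair_shift (atoms mu) (atoms nu) t x y).1 xy.
move=> [zx /(paired_inP _ mC smu' snu')[y [nuy xy Cxy]]]; split.
  move=> i; have := zx i; rewrite /t !mxE mulr0z; move: (x 0 i) (_%:~R) => a b.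
  by move=> /andP[? ?]; apply/andP; split; lra.
apply/paired_inP => //; exists (y - t); split.
- by move: nuy; rewrite anu.
- apply: (stable_pair_shift (atoms mu) (atoms nu) t x (y - t)).2.
  by rewrite subrK -amu -anu.
- by have := Ct (- t) _ _ Cxy; rewrite addrK.
Qed.

Definition far (s : R) : set (E * E) := [set e | s < enorm (e.1 - e.2)].
Definition near (s : R) : set (E * E) := [set e | enorm (e.1 - e.2) <= s].

Lemma measurable_far s : measurable (far s).
Proof.
rewrite -[X in measurable X]setTI.
have := measurable_fun_ltr (measurable_cst s)
  (measurable_enorm_sub (measurable_fst (T1 := E) (T2 := E)) measurable_snd).
by move=> /(_ measurableT [set true]); exact.
Qed.

Lemma measurable_near s : measurable (near s).
Proof.
rewrite (_ : near s = ~` far s); first by apply: measurableC; exact: measurable_far.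
by apply/seteqP; split => e /=; rewrite /near /far/= leNgt => /negP.
Qed.

Lemma far_shift s t x y : far s (x, y) -> far s (x + t, y + t).
Proof. by rewrite /far /= opprD addrACA subrr addr0. Qed.

Import HBNNSimple.

(* [f] need not be measurable: the given matching [m] is only controlled off a
   null set. *)
Lemma le_integral_majorant dT (T : measurableType dT) (mu : {measure set T -> \bar R})
    (f g : T -> \bar R) : (forall x, 0 <= f x)%E -> (forall x, 0 <= g x)%E ->
  measurable_fun setT g -> {ae mu, forall x, f x <= g x}%E ->
  (\int[mu]_x f x <= \int[mu]_x g x)%E.
Proof.
move=> f0 g0 mg fg; rewrite [leLHS]ge0_integralTE//.
apply: ge_ereal_sup => _ [h hf <-]; rewrite -integralT_nnsfun.
apply: ae_ge0_le_integral => //.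
- by move=> x _; rewrite lee_fin; exact: fun_ge0.
- by apply/measurable_EFinP; exact: measurable_funP.
- by apply: filterS fg => x le _; exact: le_trans (hf x) le.
Qed.

Lemma continuous_measurable_rV (f : E -> R) : continuous f -> measurable_fun setT f.
Proof.
move=> cf; apply: (measurability _ (RGenOpens.measurableE R)) => _ [_ [a [b ->]] <-].
rewrite setTI; apply: sub_sigma_algebra.
by apply: open_comp => [x _|]; [exact: cf|exact: interval_open].
Qed.

Section process_pair.
Context disp (Omega : measurableType disp) (P : probability Omega R).
Variables (red blue : Omega -> N).
Hypotheses (red_pp : point_process (@bounded_rV R d) red)
  (blue_pp : point_process (@bounded_rV R d) blue).
Hypothesis red_blue : indep_rv P red blue.
Hypotheses (red_ti : translation_invariant P red)
  (blue_ti : translation_invariant P blue).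

Let mred := red_pp.1.
Let mblue := blue_pp.1.
Let sred := red_pp.2.
Let sblue := blue_pp.2.

Lemma measurable_pair_count A C : measurable A -> measurable C ->
  measurable_fun setT (fun w => paired_count A C (red w, blue w)).
Proof.
move=> mA mC; apply: (measurableT_comp (measurable_paired_count mA mC)).
exact: measurable_fun_pair.
Qed.

(** The joint law is translation invariant because both marginals are and a common translation keeps
    the processes independent. *)
Lemma integral_paired_count_cube z (C : set (E * E)) : measurable C ->
  (forall t x y, C (x, y) -> C (x + t, y + t)) ->
  (\int[P]_w paired_count (int_cube z) C (red w, blue w) =
   \int[P]_w paired_count (int_cube 0) C (red w, blue w))%E.
Proof.
move=> mC Ct; pose t := - (map_mx (fun k : int => k%:~R) z : E).
under eq_integral do rewrite paired_count_translate//.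
have mr : measurable_fun setT (translate t \o red).
  exact: (measurableT_comp (measurable_translate t) mred).
have mb : measurable_fun setT (translate t \o blue).
  exact: (measurableT_comp (measurable_translate t) mblue).
have rb : indep_rv P (translate t \o red) (translate t \o blue).
  move=> A B mA mB.
  have mt (D : set N) : measurable D -> measurable (translate t @^-1` D).
    by move=> mD; have := measurable_translate t; move=> /(_ measurableT D mD); rewrite setTI.
  exact: (red_blue (mt _ mA) (mt _ mB)).
have mg : measurable_fun setT (paired_count (int_cube 0) C).
  by apply: measurable_paired_count => //; exact: measurable_int_cube.
apply: (@joint_integral _ _ _ _ _ _ _ _ _ _ mred mblue red_blue
  _ _ mr mb rb (red_ti t) (blue_ti t) _ mg).
by move=> p; exact: measure_ge0.
Qed.

Variable m : Omega -> Measures (Upair E) R.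
Hypothesis paired : {ae P, forall w,
  perfectly_paired (atoms (red w)) (atoms (blue w)) /\
  forall x y, atoms (red w) x -> atoms (blue w) y ->
    stable_pair (atoms (red w)) (atoms (blue w)) x y ->
    partner (m w) x = y /\ 0 < enorm (x - y)}.
Let lam := mean_measure P red (@unit_cube R d).
Hypothesis lam_fin : (lam < +oo)%E.

Let Q0 := @int_cube R d 0.
Let mQ0 : measurable Q0. Proof. exact: measurable_int_cube. Qed.

Let lam_ge0 : (0 <= lam)%E.
Proof. by apply: integral_ge0 => w _; exact: measure_ge0. Qed.

(** A red point has only one stable partner, so it is not counted both as near and as far. *)
Let near_far_count s : (\int[P]_w paired_count Q0 (near s) (red w, blue w) +
  \int[P]_w paired_count Q0 (far s) (red w, blue w) <= lam)%E.
Proof.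
have mn := measurable_pair_count mQ0 (measurable_near s).
have mf := measurable_pair_count mQ0 (measurable_far s).
rewrite -ge0_integralD//.
rewrite /lam /mean_measure -int_cube0; apply: le_integral_majorant.
- by move=> w; apply: adde_ge0; exact: measure_ge0.
- by move=> w; exact: measure_ge0.
- exact: (measurableT_comp (measurable_eval mQ0) mred).
apply: filterS paired => w [PP _].
set F := [set x | paired_in (far s) (red w, blue w, x)].
have mF : measurable F by apply: measurable_section; exact: measurable_paired_in (measurable_far s).
have -> : (red w : measures E R) Q0 = (mass (red w) (Q0 `\` F) + mass (red w) (Q0 `&` F))%E.
  rewrite /mass simple_lf_regular// -measureDI//.
apply: leeD => //; rewrite /paired_count/= /mass simple_lf_regular//.
have [_ muE] := simple_lfP (sred w).
have mnear := measurable_paired_section (red w, blue w) mQ0 (measurable_near s).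
rewrite !muE//; last exact: measurableD.
apply: le_counting => x [redx [Qx /(paired_inP _ (measurable_near s) (sred w) (sblue w))]].
move=> [y [bluey xy xyn]]; split => //; split => //.
move=> /(paired_inP _ (measurable_far s) (sred w) (sblue w))[y' [bluey' xy' xyf]].
move: xyf xyn; rewrite (pair_inj_r PP redx bluey bluey' xy xy') /near /far /=.
by rewrite leNgt => ->.
Qed.

Let match_count r w : \bar R :=
  counting [set x | [/\ atoms (red w) x, @unit_cube R d x &
                       (enorm (x - partner (m w) x) <= r)%R]].

Let match_count_near r : 
  (\int[P]_w match_count r w <= \int[P]_w paired_count Q0 (near r) (red w, blue w))%E.
Proof.
apply: le_integral_majorant.
- by move=> w; exact: (measure_ge0 (@counting _ R)).
- by move=> w; exact: measure_ge0.
- by apply: measurable_pair_count => //; exact: measurable_near.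
apply: filterS paired => w [PP PM].
rewrite /paired_count/= /mass simple_lf_regular//.
have [_ ->] := simple_lfP (sred w); last first.
  exact: measurable_paired_section (measurable_near r).
apply: le_counting => x [redx cubex le]; split => //; split.
  by rewrite /Q0 int_cube0.
apply/(paired_inP _ (measurable_near r) (sred w) (sblue w)).
have [y [[bluey xy] _]] := PP.1 x redx; exists y; split => //.
by have [<- _] := PM x y redx bluey xy.
Qed.

Let match_count0 : (\int[P]_w match_count 0%R w = 0)%E.
Proof.
apply/eqP; rewrite eq_le; apply/andP; split; last first.
  by apply: integral_ge0 => w _; exact: (measure_ge0 (@counting _ R)).
rewrite -(integral0 P setT); apply: le_integral_majorant => //.
apply: filterS paired => w [PP PM].
rewrite [leLHS](_ : _ = 0%E)//; apply/counting_eq0; rewrite -subset0 => x [redx _].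
have [y [[bluey xy] _]] := PP.1 x redx.
by have [-> lt] := PM x y redx bluey xy; rewrite leNgt lt.
Qed.

Variables (disp' : measure_display) (Omega' : measurableType disp')
  (Q : probability Omega' R) (X : {RV Q >-> R}).
Hypothesis X_cdf : forall r : R, 0 <= r -> cdf X r = matching_distance_cdf P red m r.
Hypothesis X_moment : ('E_Q[fun w => (X w ^+ d)%R] <> +oo)%E.

Let mXle r : measurable [set w | X w <= r].
Proof.
rewrite -[X in measurable X]setTI.
have mX : measurable_fun setT X by exact: measurable_funP.
have := measurable_fun_ler mX (measurable_cst r).
by move=> /(_ measurableT [set true]); exact.
Qed.

Let cdfE r : cdf X r = Q [set w | X w <= r].
Proof.
rewrite /cdf /distribution /pushforward (_ : X @^-1` _ = [set w | X w <= r])//.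
Qed.

Let X_gt0 : Q [set w | X w <= 0] = 0%E.
Proof.
by rewrite -cdfE X_cdf// /matching_distance_cdf match_count0 mule0.
Qed.

(** Near pairs use up at least [lam * F(s)] of the intensity, which leaves at most
    [lam * (1 - F(s))] for far ones. For negative [s], where [F] is not prescribed, the tail is one
    because [X] is almost surely positive. *)
Let far_count s :
  (\int[P]_w paired_count Q0 (far s) (red w, blue w) <= lam * Q [set w | (s < X w)%R])%E.
Proof.
have lamfin : lam \is a fin_num by rewrite ge0_fin_numE.
have QC r : (Q [set w | (X w <= r)%R] + Q [set w | (r < X w)%R] = 1)%E.
  have := probability_setC Q (mXle r).
  rewrite (_ : ~` [set w | X w <= r] = [set w | r < X w]); last first.
    by apply/seteqP; split => w /=; rewrite ltNge => /negP.
  by move=> ->; rewrite addeC subeK//; exact: fin_num_measure.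
have near0 r : (0 <= \int[P]_w paired_count Q0 (near r) (red w, blue w))%E.
  by apply: integral_ge0 => w _; exact: measure_ge0.
have [s0|s0] := leP 0 s; last first.
  have -> : Q [set w | s < X w] = 1%E.
    have := QC 0; rewrite X_gt0 add0e => Q1.
    apply/eqP; rewrite eq_le probability_le1/=; last first.
      rewrite (_ : [set w | s < X w] = ~` [set w | X w <= s]); first exact: measurableC.
      by apply/seteqP; split => w /=; rewrite ltNge => /negP.
    rewrite -Q1 le_measure ?inE//.
    - rewrite (_ : [set w | 0 < X w] = ~` [set w | X w <= 0]); first exact: measurableC.
      by apply/seteqP; split => w /=; rewrite ltNge => /negP.
    - rewrite (_ : [set w | s < X w] = ~` [set w | X w <= s]); first exact: measurableC.
      by apply/seteqP; split => w /=; rewrite ltNge => /negP.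
    - by move=> w /=; exact: lt_trans.
  rewrite mule1; apply: le_trans (near_far_count s); rewrite leeDr//.
have lamF : (lam * Q [set w | (X w <= s)%R] <=
    \int[P]_w paired_count Q0 (near s) (red w, blue w))%E.
  rewrite -cdfE X_cdf// /matching_distance_cdf -/lam.
  have [->|lam0] := eqVneq lam 0%E; first by rewrite mul0e.
  by rewrite muleA divee// mul1e; exact: match_count_near.
have Qfin : Q [set w | X w <= s] \is a fin_num by exact: fin_num_measure.
rewrite -(@leeD2lE _ (lam * Q [set w | (X w <= s)%R])%E) ?fin_numM//.
rewrite -muleDr// ?QC ?mule1; last by rewrite ge0_adde_def ?inE.
by apply: le_trans (near_far_count s); rewrite leeD2r.
Qed.

(* By translation invariance the cube at [z] contributes at most
   [lam * P (|z| < 4 X + c + 2)], whose sum over [z] is a [d]-th moment. *)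
Lemma ae_finite_long_pairs (c : R) : 0 <= c ->
  {ae P, forall w, finite_set [set x | atoms (red w) x /\
     exists y, [/\ atoms (blue w) y,
                   stable_pair (atoms (red w)) (atoms (blue w)) x y &
                   `|x| <= 4 * enorm (x - y) + c]]}.
Proof.
move=> c0; pose C : set (E * E) := [set e | `|e.1| <= 4 * enorm (e.1 - e.2) + c].
have mC : measurable C.
  rewrite -[X in measurable X]setTI.
  have mn : measurable_fun setT (fun e : E * E => `|e.1|).
    apply: (measurableT_comp (f := fun x : E => `|x|)) => //.
    by apply: continuous_measurable_rV; exact: norm_continuous.
  have me := measurable_enorm_sub (measurable_fst (T1 := E) (T2 := E)) measurable_snd.
  have := measurable_fun_ler mn (measurable_funD (measurable_funM (measurable_cst (4 : R)) me) (measurable_cst c)).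
  by move=> /(_ measurableT [set true]); exact.
pose W w : \bar R := paired_count setT C (red w, blue w).
have mW : measurable_fun setT W by exact: measurable_pair_count.
have W0 w : (0 <= W w)%E by exact: measure_ge0.
pose S w := [set x | paired_in C (red w, blue w, x)].
have mS w : measurable (S w) by apply: measurable_section; exact: measurable_paired_in.
have WE w : W w = (\sum_(n <oo) paired_count (nat_cube n) C (red w, blue w))%E.
  rewrite /W /paired_count /mass setTI -/(S w).
  have {1}-> : S w = \bigcup_n (nat_cube n `&` S w).
    by rewrite -setI_bigcupl bigcup_nat_cube setTI.
  rewrite measure_semi_bigcup//.
  - by move=> n; apply: measurableI => //; exact: measurable_nat_cube.
  - by apply: trivIset_setIr; exact: trivIset_nat_cube.
  - by apply: bigcup_measurable => n _; apply: measurableI => //; exact: measurable_nat_cube.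
have W_fin : (\int[P]_w W w < +oo)%E.
  under eq_integral do rewrite WE.
  have mn n := measurable_pair_count (measurable_nat_cube n) mC.
  rewrite integral_nneseries//.
  (* In [c + 2], one unit accounts for the position of [x] inside its cube and one makes the
     inequality strict. *)
  have := @lattice_moment R d _ _ Q X (c + 2) _ X_gt0 X_moment.
  move=> /(_ ltac:(lra)) sum_fin.
  pose u := fun n : nat => if pickle_inv n is Some z
    then Q [set w | ((lattice_norm R (z : 'rV[int]_d) - (c + 2)) / 4 < X w)%R] else 0%E.
  have u0 n : (0 <= u n)%E by rewrite /u; case: pickle_inv.
  apply: (@le_lt_trans _ _ (\sum_(n <oo) (fine lam)%:E * u n)%E); last first.
    rewrite nneseriesZl//.
    by apply: lte_mul_pinfty => //; rewrite ?lee_fin ?fine_ge0.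
  apply: lee_nneseries.
    by move=> n _ _; apply: integral_ge0 => w _; exact: measure_ge0.
  move=> n _; rewrite /u /nat_cube fineK ?ge0_fin_numE//.
  case: (pickle_inv n) => [z|]; last first.
    rewrite mule0 integral0_eq// => w _.
    by rewrite /paired_count set0I /mass measure0.
  apply: le_trans (far_count _).
  rewrite -(integral_paired_count_cube z (measurable_far _)); last first.
    by move=> t x y; exact: far_shift.
  have mzC := measurable_pair_count (measurable_int_cube z) mC.
  have mzf s := measurable_pair_count (measurable_int_cube z) (measurable_far s).
  apply: ge0_le_integral => //; move=> w _; rewrite /paired_count/=; apply: le_measure; rewrite ?inE.
  - by apply: measurable_paired_section => //; exact: measurable_int_cube.
  - by apply: measurable_paired_section; [exact: measurable_int_cube|exact: measurable_far].
  move=> x [zx /(paired_inP _ mC (sred w) (sblue w))[y [bluey xy Cxy]]]; split => //.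
  apply/(paired_inP _ (measurable_far _) (sred w) (sblue w)); exists y; split => //.
  move: Cxy; rewrite /C /far /= => Cxy.
  have : lattice_norm R z <= `|x| + 1.
    apply: norm_le_coord => [|i]; first by rewrite addr_ge0.
    rewrite mxE; have := zx i; have := coord_le_norm x i.
    rewrite ler_norml => /andP[h1 h2] /andP[h3 h4].
    by rewrite ler_norml; apply/andP; split; lra.
  by move=> h; rewrite ltr_pdivrMr//; lra.
have : P.-integrable setT W.
  apply/integrableP; split => //.
  by under eq_integral do rewrite gee0_abs//.
move=> /(integrable_ae measurableT); apply: filterS => w /(_ I).
rewrite ge0_fin_numE// /W /paired_count /mass/= simple_lf_regular// setTI.
have [_ ->] := simple_lfP (sred w); last exact: mS.
move=> /finite_counting.
apply: sub_finite_set => x [redx [y [bluey xy le]]]; split => //.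
by apply/(paired_inP _ mC (sred w) (sblue w)); exists y.
Qed.

End process_pair.

End far_pairs.

(** * Insertion and deletion of points *)

Section cube_probability.
Context (R : realType).

Lemma closed_unit_cube_row_mx d (a : R) (v : 'rV[R]_d) :
  @closed_unit_cube R (1 + d)%N (row_mx (a%:M : 'rV_1) v) <->
  0 <= a <= 1 /\ closed_unit_cube v.
Proof.
split => [h|[a01 v01] i].
  split; first by have := h (lshift d (0 : 'I_1)); rewrite row_mxEl mxE eqxx mulr1n.
  by move=> i; have := h (rshift 1 i : 'I_(1 + d)); rewrite row_mxEr.
have := split_ordP (i : 'I_(1 + d)).
by case => j ->; rewrite ?row_mxEl ?row_mxEr// ord1 mxE eqxx mulr1n.
Qed.

Lemma measurable_row_mx d :
  measurable_fun setT (fun av : measurableTypeR R * 'rV[R]_d => row_mx (av.1%:M : 'rV_1) av.2 : 'rV[R]_(1 + d)).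
Proof.
apply: measurable_rV => i; have := split_ordP (i : 'I_(1 + d)).
case => j ->.
  rewrite (_ : (fun t => _) = fst); first exact: measurable_fst.
  by apply/funext => -[a v] /=; rewrite row_mxEl ord1 mxE eqxx mulr1n.
rewrite (_ : (fun t => _) = (fun v : 'rV[R]_d => v 0 j) \o snd).
  by apply: measurableT_comp => //; exact: measurable_coord.
by apply/funext => -[a v] /=; rewrite row_mxEr.
Qed.

(** [lebesgue_rV] is a bare set function. Its restriction to the cube is realised as a probability
    by pushing forward the product of the uniform law on [[0, 1]] with the law of one dimension
    less. *)
Lemma cube_probability d : exists rho : probability 'rV[R]_d R,
  forall A, measurable A -> lebesgue_rV (A `&` @closed_unit_cube R d) = rho A.
Proof.
elim: d => [|d [rho rhoE]].
  exists (dirac (0 : 'rV[R]_0)) => A mA /=.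
  rewrite (_ : @closed_unit_cube R 0 = setT) ?setIT//.
  by rewrite -subTset => x _ [].
pose F : {mfun (measurableTypeR R * 'rV[R]_d)%type >-> 'rV[R]_(1 + d)} :=
  HB.pack (fun av : measurableTypeR R * 'rV[R]_d => row_mx (av.1%:M : 'rV_1) av.2 : 'rV[R]_(1 + d))
    (isMeasurableFun.Build _ _ _ _ _ (@measurable_row_mx d)).
pose U := @uniform_prob R 0 1 ltr01.
exists (distribution (U \x rho)%E F) => A mA.
have mFA : measurable (F @^-1` A).
  by rewrite -[X in measurable X]setTI; exact: (measurable_row_mx measurableT mA).
have mAa (a : R) : measurable [set v | A (row_mx (a%:M : 'rV_1) v : 'rV[R]_(1 + d))].
  by have := measurable_xsection a mFA; rewrite xsectionE.
have := @integral_uniform R 0 1 ltr01 (rho \o xsection (F @^-1` A))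
  (measurable_fun_xsection rho mFA) (fun=> measure_ge0 _ _).
rewrite subr0 invr1 mul1e => IU; apply: etrans (esym IU).
rewrite [RHS]integral_mkcond /=.
apply: eq_integral => a _; rewrite patchE.
case: ifPn => [|/negP] a01.
  rewrite /= xsectionE -rhoE; last exact: mAa.
  congr (lebesgue_rV _); apply/seteqP; split => v /=.
    by move=> [Av /closed_unit_cube_row_mx[]].
  move=> [Av v01]; split => //; apply/closed_unit_cube_row_mx; split => //.
  by move: a01; rewrite inE /= in_itv.
rewrite (_ : [set v | _] = set0 `&` @closed_unit_cube R d).
  by rewrite rhoE// measure0.
rewrite set0I -subset0 => v [_ /closed_unit_cube_row_mx[a01' _]]; apply: a01.
by rewrite inE/= in_itv.
Qed.

Lemma measurable_closed_unit_cube d : measurable (@closed_unit_cube R d).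
Proof.
rewrite (_ : @closed_unit_cube R d = \bigcap_(i in [set: 'I_d])
    (fun x : 'rV[R]_d => x 0 i) @^-1` `[0, 1]%classic).
  apply: fin_bigcap_measurable => // i _; rewrite -[X in measurable X]setTI.
  by apply: measurable_coord.
apply/seteqP; split => [x x01 i _|x x01 i] /=; first by rewrite in_itv/=.
by have := x01 i I; rewrite /= in_itv.
Qed.

Lemma closed_unit_cube_norm d (x : 'rV[R]_d) : closed_unit_cube x -> `|x| <= 1.
Proof.
move=> x01; apply: norm_le_coord => // i; have /andP[x0 x1] := x01 i.
by rewrite ger0_norm.
Qed.

End cube_probability.

(** * Measurable insertion and removal of a single point *)

Section point_operations.
Context (R : realType) (d : nat).
Local Notation E := 'rV[R]_d.
Local Notation N := (Measures E R).
Local Notation slf := (simple_lf (@bounded_rV R d)).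

Lemma measurable_add_point : measurable_fun setT (fun p : N * E => add_point p.1 p.2).
Proof.
apply: measurable_Measures => A mA.
rewrite (_ : (fun s => _) = (fun p : N * E =>
    ((p.1 : measures E R) A + (\1_A p.2)%:E)%E)); last first.
  by apply/funext => p; rewrite add_pointE.
apply: emeasurable_funD.
  exact: (measurableT_comp (measurable_eval mA) measurable_fst).
apply/measurable_EFinP.
exact: (measurableT_comp (measurable_indic mA) measurable_snd).
Qed.

(** Local finiteness leaves room around [x] for a rational ball without other atoms. Thus countably
    many deletion rules reach every atom. *)
Lemma isolating_ball (mu : N) (x : E) : slf mu -> atoms mu x ->
  exists2 n, (mu : measures E R) (rat_ball n) = 1%E & rat_ball n x.
Proof.
move=> smu mux; have [mulf _] := simple_lfP smu.
pose D := (atoms mu `&` ball x 1) `\ x.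
have finD : finite_set D.
  apply: finite_setD; apply: mulf; apply: norm_le_bounded_set; exists (`|x| + 1) => y.
  rewrite mx_norm_ball /ball_/= => xy; rewrite -(subKr x y).
  by apply: le_trans (ler_normB _ _) _; rewrite lerD2l ltW.
have oD : open (~` D).
  apply: closed_openC.
  have acc : accessible_space E by exact/hausdorff_accessible/norm_hausdorff.
  by move/accessible_finite_set_closed : acc; apply.
have /nbhs_ballP[e /= e0 eD] : nbhs x (~` D).
  by apply: open_nbhs_nbhs; split => // -[_]; apply.
have me : 0 < Num.min e 1 by rewrite lt_min e0 ltr01.
have [n nx ne] := rat_ballP x me; exists n => //.
apply/(simple_lf_eq1 smu (measurable_rat_ball n)); exists x; split => // y [muy ny].
apply: contrapT => xy; apply: (eD y).
  by apply: le_ball (ne _ ny); rewrite ge_min lexx.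
split; last by move=> yx; apply: xy.
by split => //; apply: le_ball (ne _ ny); rewrite ge_min lexx orbT.
Qed.

Definition trial_ball (n j : nat) : set E := rat_ball (if j is j'.+1 then j' else n).

Lemma measurable_trial_ball n j : measurable (trial_ball n j).
Proof. exact: measurable_rat_ball. Qed.

Definition first_trial (n j : nat) : set N :=
  [set mu | (mu : measures E R) (trial_ball n j) = 1%E /\
            forall i, (i < j)%N -> (mu : measures E R) (trial_ball n i) <> 1%E].

Lemma measurable_first_trial n j : measurable (first_trial n j).
Proof.
have m1 i : measurable [set mu : N | (mu : measures E R) (trial_ball n i) = 1%E].
  rewrite -[X in measurable X]setTI.
  have mev : measurable_fun setT (fun mu : N => (mu : measures E R) (trial_ball n i)).
    by apply: measurable_eval; exact: measurable_trial_ball.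
  exact: (mev measurableT [set 1%E] (emeasurable_set1 _)).
apply: measurableI; first exact: m1.
rewrite (_ : (fun mu => _) = \bigcap_(i in [set i | (i < j)%N])
    ~` [set mu : N | (mu : measures E R) (trial_ball n i) = 1%E]).
  by apply: bigcap_measurableType => i _; exact: measurableC.
by apply/seteqP; split => mu h i /h.
Qed.

Lemma first_trial_inj n i j mu : first_trial n i mu -> first_trial n j mu -> i = j.
Proof.
move=> [i1 iF] [j1 jF]; have [ij|ji|//] := ltngtP i j; first by have := jF _ ij.
by have := iF _ ji.
Qed.

Lemma first_trial_ex n j mu : (mu : measures E R) (trial_ball n j) = 1%E ->
  exists i, first_trial n i mu.
Proof.
move=> muj.
have ex : exists i, `[< (mu : measures E R) (trial_ball n i) = 1%E >] by exists j; apply/asboolP.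
exists (ex_minn ex); case: ex_minnP => i /asboolP mui imin; split => // k ki muk.
by have := imin k; rewrite leqNgt ki => /(_ (introT (asboolP _) muk)).
Qed.

(* Falling back on the balls 0, 1, 2, ... when the ball [n] does not contain
   exactly one point makes the deleted point an atom almost surely, as deletion
   tolerance requires. *)
Definition delete_point (n : nat) (mu : N) : N :=
  if pselect (exists j, first_trial n j mu) is left ex
  then mrestr (mu : measures E R) (measurableC (measurable_trial_ball n (sval (cid ex))))
  else mu.

Lemma delete_pointE n j mu A : first_trial n j mu ->
  (delete_point n mu : measures E R) A = (mu : measures E R) (A `&` ~` trial_ball n j).
Proof.
move=> muj; rewrite /delete_point; case: pselect => [ex|]; last by case; exists j.
by case: (cid ex) => i /= mui; rewrite /mrestr (first_trial_inj mui muj).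
Qed.

Lemma delete_pointN n mu : (forall j, ~ first_trial n j mu) -> delete_point n mu = mu.
Proof. by move=> nex; rewrite /delete_point; case: pselect => // -[j muj]; case: (nex j). Qed.

Lemma measurable_first_trial_cases dS (S : measurableType dS) n (f : N -> S)
    (f' : nat -> N -> S) (f0 : N -> S) :
  (forall j mu, first_trial n j mu -> f mu = f' j mu) ->
  (forall mu, (forall j, ~ first_trial n j mu) -> f mu = f0 mu) ->
  (forall j, measurable_fun setT (f' j)) -> measurable_fun setT f0 ->
  measurable_fun setT f.
Proof.
move=> ff' ff0 mf' mf0 _ B mB; rewrite setTI.
rewrite (_ : f @^-1` B = (\bigcup_j (first_trial n j `&` f' j @^-1` B)) `|`
    (~` (\bigcup_j first_trial n j) `&` f0 @^-1` B)).
  apply: measurableU.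
    apply: bigcupT_measurable => j; apply: measurableI; first exact: (measurable_first_trial n j).
    by rewrite -[X in measurable X]setTI; exact: (mf' j measurableT _ mB).
  apply: measurableI.
    apply: measurableC; apply: bigcupT_measurable => j; exact: (measurable_first_trial n j).
  by rewrite -[X in measurable X]setTI; exact: (mf0 measurableT _ mB).
apply/seteqP; split => mu /=.
  move=> Bf; have [[j muj]|nex] := pselect (exists j, first_trial n j mu).
    by left; exists j => //; split => //=; rewrite -ff'.
  right; split; first by move=> [j _ muj]; apply: nex; exists j.
  by rewrite /= -ff0// => j muj; apply: nex; exists j.
move=> [[j _ [muj]]|[nex]] /=; first by rewrite -ff'.
by rewrite -ff0// => j muj; apply: nex; exists j.
Qed.

Lemma measurable_delete_point n : measurable_fun setT (delete_point n).
Proof.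
apply: measurable_Measures => A mA.
apply: (@measurable_first_trial_cases _ _ n _
  (fun j mu => (mu : measures E R) (A `&` ~` trial_ball n j)) (fun mu => (mu : measures E R) A)).
- by move=> j mu; exact: delete_pointE.
- by move=> mu /delete_pointN ->.
- move=> j; apply: measurable_eval; apply: measurableI => //; apply: measurableC.
  exact: measurable_trial_ball.
- exact: measurable_eval.
Qed.

Lemma delete_point_isolated n mu x : slf mu -> atoms mu x ->
  (mu : measures E R) (rat_ball n) = 1%E -> rat_ball n x ->
  slf (delete_point n mu) /\ atoms (delete_point n mu) = atoms mu `\ x.
Proof.
move=> smu mux mun nx; have mu0 : first_trial n 0 mu by split.
have mB := measurableC (measurable_trial_ball n 0).
have [sr ar] := atoms_restr mB smu.
have [rlf rE] := simple_lfP sr.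
have [] := @simple_lf_of_counting R d (delete_point n mu) _ rlf.
  by move=> A mA; rewrite (delete_pointE _ mu0) -rE.
move=> sdel ->; split => //; rewrite ar.
have [z [[muz nz] zu]] := (simple_lf_eq1 smu (measurable_rat_ball n)).1 mun.
apply/seteqP; split => y [muy ny]; split => //.
  by move=> yx; apply: ny; rewrite yx.
by move=> nyb; apply: ny; rewrite /= -(zu x)// -(zu y).
Qed.

(** The point to which deletion tolerance is applied. A successful trial ball contains a single
    atom, so [xget] has no choice to make; the default [0] occurs when no trial succeeds. *)
Definition deleted_point (n : nat) (mu : N) : E :=
  xget 0 [set x | exists j, [/\ first_trial n j mu, atoms mu x & trial_ball n j x]].

Lemma deleted_pointP n j mu : slf mu -> first_trial n j mu ->
  atoms mu (deleted_point n mu) /\ trial_ball n j (deleted_point n mu).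
Proof.
move=> smu muj; rewrite /deleted_point; case: xgetP => [x _ [i [mui mux ix]]|].
  by rewrite (first_trial_inj muj mui).
have [z [[muz jz] _]] := (simple_lf_eq1 smu (measurable_trial_ball n j)).1 muj.1.
by move=> /(_ z); case; exists j.
Qed.

(** Restriction to the complement of a ball is visibly measurable in [mu], while tolerance speaks of
    removing one atom. If no trial succeeds, [isolating_ball] shows that there are no atoms, and
    both sides vanish. *)
Lemma delete_point_ext n mu A : slf mu -> measurable A ->
  (delete_point n mu : measures E R) A =
  (remove_point mu (deleted_point n mu) : measures E R) A.
Proof.
move=> smu mA; rewrite /= /mrestr; have [mulf muE] := simple_lfP smu.
have mz : measurable (A `&` ~` [set deleted_point n mu]).
  by apply: measurableI => //; apply: measurableC; exact: measurable_mx_set1.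
have [[j muj]|nex] := pselect (exists j, first_trial n j mu).
  rewrite (delete_pointE _ muj).
  have [muz jz] := deleted_pointP smu muj.
  have mj : measurable (A `&` ~` trial_ball n j).
    by apply: measurableI => //; apply: measurableC; exact: measurable_trial_ball.
  rewrite !muE//; congr counting; apply/seteqP; split => x [mux [Ax nx]]; split => //; split => //.
    by move=> /= xz; apply: nx; rewrite xz.
  move=> jx; apply: nx => /=.
  have [z [_ zu]] := (simple_lf_eq1 smu (measurable_trial_ball n j)).1 muj.1.
  by rewrite -(zu x)// -(zu (deleted_point n mu)).
rewrite delete_pointN => [|j muj]; last by apply: nex; exists j.
have noatom x : ~ atoms mu x.
  move=> mux; have [k muk _] := isolating_ball smu mux.
  by apply: nex; apply: (@first_trial_ex n k.+1).
by rewrite !muE//; congr counting; apply/seteqP; split => x [/noatom].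
Qed.

End point_operations.

(** * Transport of almost sure events by tolerance *)

Section tolerance.
Context (R : realType) (d : nat).
Local Notation E := 'rV[R]_d.
Local Notation N := (Measures E R).
Local Notation slf := (simple_lf (@bounded_rV R d)).
Context disp (Omega : measurableType disp) (P : probability Omega R).
Variables (red blue : Omega -> N).
Hypotheses (red_pp : point_process (@bounded_rV R d) red)
  (blue_pp : point_process (@bounded_rV R d) blue).
Hypothesis red_blue : indep_rv P red blue.

Let mred := red_pp.1.
Let mblue := blue_pp.1.
Let sred := red_pp.2.
Let sblue := blue_pp.2.

Definition full (G : set (N * N)) : Prop :=
  measurable G /\ P [set w | ~ G (red w, blue w)] = 0%E.

Lemma ae_full G : full G -> {ae P, forall w, G (red w, blue w)}.
Proof.
move=> [mG PG0]; exists [set w | ~ G (red w, blue w)]; split => //.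
have mrb : measurable_fun setT (fun w => (red w, blue w)) by exact: measurable_fun_pair.
rewrite -[X in measurable X]setTI.
exact: (mrb measurableT _ (measurableC mG)).
Qed.

Lemma full_ae G : measurable G -> {ae P, forall w, G (red w, blue w)} -> full G.
Proof.
move=> mG aeG; split => //; apply: measure_negligible aeG.
have mrb : measurable_fun setT (fun w => (red w, blue w)) by exact: measurable_fun_pair.
rewrite -[X in measurable X]setTI.
exact: (mrb measurableT _ (measurableC mG)).
Qed.

(** The number of modifications will depend on the sample, so all [k] are treated outside a single
    null set. *)
Lemma full_iter (Psi : set (N * N) -> set (N * N)) G :
  (forall G', full G' -> full (Psi G')) -> full G ->
  {ae P, forall w, forall k, iter k Psi G (red w, blue w)}.
Proof.
move=> PsiF GF; apply/ae_foralln => k; apply: ae_full.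
by elim: k => [//|k IH] /=; exact: PsiF.
Qed.

Definition delete_closure (G : set (N * N)) : set (N * N) :=
  [set p | forall n, G (delete_point n p.1, p.2)].

(** If trial [j] succeeds, the deleted point lies in [A] exactly when [A] contains the unique atom
    of that ball, which is a condition on one evaluation. *)
Lemma measurable_deleted_point n :
  measurable_fun setT (fun w => deleted_point n (red w)).
Proof.
move=> _ A mA; rewrite setTI.
rewrite (_ : _ @^-1` A = red @^-1` ((\bigcup_j (first_trial n j `&`
      [set mu : N | (mu : measures E R) (A `&` trial_ball n j) = 1%E])) `|`
    (~` (\bigcup_j first_trial n j) `&` [set mu : N | A 0]))).
  rewrite -[X in measurable X]setTI; apply: mred => //; apply: measurableU.
    apply: bigcupT_measurable => j; apply: measurableI.
      exact: (measurable_first_trial n j).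
    have mev : measurable_fun setT (fun mu : N => (mu : measures E R) (A `&` trial_ball n j)).
      by apply: measurable_eval; apply: measurableI => //; exact: measurable_trial_ball.
    rewrite -[X in measurable X]setTI.
    exact: (mev measurableT [set 1%E] (emeasurable_set1 _)).
  apply: measurableI.
    by apply: measurableC; apply: bigcupT_measurable => j; exact: (measurable_first_trial n j).
  have [A0|nA0] := pselect (A 0).
    by rewrite (_ : [set mu | _] = setT)//; apply/seteqP; split.
  by rewrite (_ : [set mu | _] = set0)//; apply/seteqP; split.
have mAj j : measurable (A `&` trial_ball n j).
  by apply: measurableI => //; exact: measurable_trial_ball.
apply/seteqP; split => w /=.
  move=> Aw; have [[j redj]|nex] := pselect (exists j, first_trial n j (red w)).
    left; exists j => //; split => //=.
    have [rz jz] := deleted_pointP (sred w) redj.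
    apply/(simple_lf_eq1 (sred w) (mAj j)); exists (deleted_point n (red w)); split => //.
    move=> y [ry [_ jy]].
    have [z [_ zu]] := (simple_lf_eq1 (sred w) (measurable_trial_ball n j)).1 redj.1.
    by rewrite -(zu y)// -(zu (deleted_point n (red w))).
  right; split; first by move=> [j _ redj]; apply: nex; exists j.
  move: Aw; rewrite /deleted_point; case: xgetP => // x _ [j [redj _ _]].
  by exfalso; apply: nex; exists j.
move=> [[j _ [redj /=]]|[nex /= A0]].
  move=> /(simple_lf_eq1 (sred w) (mAj j))[y [[ry [Ay jy]] _]].
  have [rz jz] := deleted_pointP (sred w) redj.
  have [z [_ zu]] := (simple_lf_eq1 (sred w) (measurable_trial_ball n j)).1 redj.1.
  by rewrite -(zu (deleted_point n (red w)))// (zu y).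
rewrite /deleted_point; case: xgetP => // x _ [j [redj _ _]].
by exfalso; apply: nex; exists j.
Qed.

Hypothesis red_nonempty : {ae P, forall w, exists x, atoms (red w) x}.

Lemma full_delete_closure G : deletion_tolerant P red -> full G ->
  full (delete_closure G).
Proof.
move=> tol [mG PG0].
have mg n : measurable_fun setT (fun p : N * N => (delete_point n p.1, p.2)).
  apply: measurable_fun_pair => //.
  exact: (measurableT_comp (measurable_delete_point n) measurable_fst).
have mGn n : measurable [set p | G (delete_point n p.1, p.2)].
  by rewrite -[X in measurable X]setTI; exact: (mg n measurableT _ mG).
apply: full_ae.
  rewrite (_ : delete_closure G = \bigcap_n [set p | G (delete_point n p.1, p.2)]).
    exact: bigcapT_measurable.
  by apply/seteqP; split => p h n; [move=> _|]; exact: h.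
apply/ae_foralln => n.
apply: (@ae_full [set p | G (delete_point n p.1, p.2)]); split => //.
apply: (@null_preserving_fst _ _ _ P _ _ _ _ red blue mred mblue red_blue
  (delete_point n) (measurable_delete_point n) _ (~` G) (measurableC mG) PG0).
pose Z w := deleted_point n (red w).
(* An existing atom is isolated by some rational ball, so some trial succeeds and [Z] is an atom. *)
have aeZ : {ae P, forall w, atoms (red w) (Z w)}.
  apply: filterS red_nonempty => w [x redx].
  have [k redk _] := isolating_ball (sred w) redx.
  have [j redj] := @first_trial_ex R d n k.+1 (red w) redk.
  exact: (deleted_pointP (sred w) redj).1.
move=> A mA PA0; rewrite -[RHS](tol Z (measurable_deleted_point n) aeZ A mA PA0); congr (P _).
have ext w := measurable_Measures_ext mA (fun B mB => delete_point_ext n (sred w) mB).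
by apply/seteqP; split => w /ext.
Qed.

Variable rho : probability E R.
Hypothesis rhoE : forall A, measurable A ->
  lebesgue_rV (A `&` @closed_unit_cube R d) = rho A.

(** Insertion tolerance controls only almost every inserted point, whereas [delete_closure] can
    demand all of its countably many rules. *)
Definition insert_closure (G : set (N * N)) : set (N * N) :=
  [set p | rho [set u | ~ G (add_point p.1 u, p.2)] = 0%E].

Let PxU := (P \x rho)%E.

(** The coupling demanded by insertion tolerance is the product space, with the second coordinate as
    uniform point of the cube. *)
Lemma insertion_null : insertion_tolerant P red -> forall A, measurable A ->
  P (red @^-1` A) = 0%E ->
  PxU [set wu | A (add_point (red wu.1) wu.2)] = 0%E.
Proof.
move=> tol A mA PA0.
have mcube := @measurable_closed_unit_cube R d.
have leb1 : lebesgue_rV (@closed_unit_cube R d) = 1%E.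
  by rewrite -[X in lebesgue_rV X]setTI rhoE// probability_setT.
have mr : measurable_fun setT (red \o fst : Omega * E -> N).
  exact: (measurableT_comp mred measurable_fst).
have mpre B : measurable B -> measurable (red @^-1` B).
  by move=> mB; rewrite -[X in measurable X]setTI; exact: (mred measurableT mB).
pose PU : probability (Omega * E)%type R := PxU.
have preR B : (red \o fst : Omega * E -> N) @^-1` B = (red @^-1` B) `*` setT.
  by apply/seteqP; split => [[w u]|[w u] []].
have preU B : (snd : Omega * E -> E) @^-1` B = setT `*` B.
  by apply/seteqP; split => [[w u]|[w u] []].
have PUR B : measurable B -> PU ((red \o fst) @^-1` B) = P (red @^-1` B).
  move=> mB; rewrite preR /PU/= product_measure1E//; last exact: mpre.
  by rewrite [X in (_ * X)%E]probability_setT mule1.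
have PUU B : measurable B -> PU (snd @^-1` B) = rho B.
  by move=> mB; rewrite preU /PU/= product_measure1E// [X in (X * _)%E]probability_setT mul1e.
have leb0 : (0 < lebesgue_rV (@closed_unit_cube R d))%E by rewrite leb1 lte_fin.
have leby : (lebesgue_rV (@closed_unit_cube R d) < +oo)%E by rewrite leb1 ltry.
have Rpp : point_process (@bounded_rV R d) (red \o fst : Omega * E -> N).
  by split => [|w]; [exact: mr|exact: sred].
have unif : uniform_on PU (@closed_unit_cube R d) snd.
  split; first exact: measurable_snd.
  by move=> B mB; rewrite leb1 inve1 mule1 rhoE// PUU.
have indep : indep_rv PU snd (red \o fst).
  move=> B C mB mC; rewrite PUU// PUR//.
  rewrite (_ : _ `&` _ = (red @^-1` C) `*` B); last first.
    by apply/seteqP; split => [[w u] []|[w u] []].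
  by rewrite /PU/= product_measure1E//; [rewrite muleC|exact: mpre].
exact: (tol _ mcube leb0 leby _ _ PU _ _ Rpp PUR unif indep A mA PA0).
Qed.

Lemma measurable_insertion G : measurable G ->
  measurable [set q : N * N * E | ~ G (add_point q.1.1 q.2, q.1.2)].
Proof.
move=> mG.
have mg : measurable_fun setT (fun q : N * N * E => (add_point q.1.1 q.2, q.1.2)).
  apply: measurable_fun_pair; last exact: measurableT_comp.
  have mk : measurable_fun setT (fun q : N * N * E => (q.1.1, q.2)).
    by apply: measurable_fun_pair => //; exact: measurableT_comp.
  exact: (measurableT_comp (@measurable_add_point R d) mk).
by rewrite -[X in measurable X]setTI; exact: (mg measurableT _ (measurableC mG)).
Qed.

Lemma measurable_insert_closure G : measurable G -> measurable (insert_closure G).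
Proof.
move=> mG; rewrite (_ : insert_closure G =
    ~` [set p | rho [set u | ~ G (add_point p.1 u, p.2)] <> 0%E]).
  apply: measurableC; exact: (measurable_null_section rho (measurable_insertion mG)).
by apply/seteqP; split => p /=; [move=> h; apply|exact: contrapT].
Qed.

Lemma full_insert_closure G : insertion_tolerant P red -> full G ->
  full (insert_closure G).
Proof.
move=> tol [mG PG0]; split; first exact: measurable_insert_closure.
exact: (@null_preserving_random_fst _ _ _ P _ _ _ _ red blue mred mblue red_blue
  _ _ rho (fun p => add_point p.1 p.2) (@measurable_add_point R d)
  (insertion_null tol) (~` G) (measurableC mG) PG0).
Qed.

End tolerance.

(** * The two contradictions for a fixed configuration *)

Section configurations.
Context (R : realType) (d : nat).
Local Notation E := 'rV[R]_d.
Local Notation N := (Measures E R).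
Local Notation slf := (simple_lf (@bounded_rV R d)).

Lemma chain_freeS (V V' : set E) : V `<=` V' -> chain_free V' -> chain_free V.
Proof. by move=> VV' fV' [s [sV lt]]; apply: fV'; exists s; split => // i; exact: VV'. Qed.

(** Each listed atom is removed through an isolating ball, and every removal uses up one iterate of
    the closure; listed points that are not atoms are skipped. *)
Lemma delete_points (G : set (N * N)) (mu nu : N) (s : seq E) : slf mu ->
  (forall k, iter k (@delete_closure R d) G (mu, nu)) ->
  exists mu', [/\ slf mu', atoms mu' = atoms mu `\` [set` s] &
                  forall k, iter k (@delete_closure R d) G (mu', nu)].
Proof.
move=> + + ; elim: s mu => [|x s IH] mu smu muG.
  by exists mu; split => //; rewrite set_nil setD0.
have [mux|nmux] := pselect (atoms mu x); last first.
  have [mu' [smu' amu' mu'G]] := IH mu smu muG; exists mu'; split => //.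
  rewrite amu'; apply/seteqP; split => y [muy ny]; split => //= ys; apply: ny => /=.
    by move: ys; rewrite inE => /predU1P[yx|//]; exfalso; apply: nmux; rewrite -yx.
  by rewrite inE ys orbT.
have [n mun nx] := isolating_ball smu mux.
have [sdel adel] := delete_point_isolated smu mux mun nx.
have [|mu' [smu' amu' mu'G]] := IH _ sdel.
  by move=> k; have := muG k.+1; apply.
exists mu'; split => //; rewrite amu' adel; apply/seteqP; split => y /=.
  move=> [[muy yx] ys]; split => //; rewrite inE => /predU1P[/yx//|]; exact: ys.
move=> [muy]; rewrite inE => /negP; rewrite negb_or => /andP[/eqP yx /negP ys].
by split.
Qed.

(** For each [k] the bad insertion points form a null set, and countably many null sets cannot cover
    the cube. Inclusion of [G] in [good_pairs] keeps the new points distinct from all earlier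
    ones. *)
Lemma insert_points (rho : probability E R) (G : set (N * N)) (mu nu : N) (n : nat) :
  rho (@closed_unit_cube R d) = 1%E -> measurable G -> G `<=` @good_pairs R d ->
  slf mu -> (forall k, iter k (insert_closure rho) G (mu, nu)) ->
  exists s : seq E, [/\ size s = n, uniq s &
    forall u, u \in s -> closed_unit_cube u /\ ~ atoms mu u] /\
    exists mu', [/\ slf mu', atoms mu' = atoms mu `|` [set` s] &
                    forall k, iter k (insert_closure rho) G (mu', nu)].
Proof.
move=> rho1 mG Ggood smu muG; elim: n => [|n [s [[sz us s_]] [mu' [smu' amu' mu'G]]]].
  by exists [::]; split => //; exists mu; split => //; rewrite set_nil setU0.
have mGk k : measurable (iter k (insert_closure rho) G).
  by elim: k => [//|k IH] /=; exact: measurable_insert_closure.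
have [u [ucube uG]] : exists u, closed_unit_cube u /\
    forall k, iter k (insert_closure rho) G (add_point mu' u, nu).
  apply: contrapT => nex.
  have neg k : rho.-negligible [set u | ~ iter k (insert_closure rho) G (add_point mu' u, nu)].
    apply/negligibleP; last exact: (mu'G k.+1).
    exact: (measurable_section (mu', nu) (measurable_insertion (mGk k))).
  have [C [mC C0 UC]] := negligible_bigcup neg.
  have : (rho (@closed_unit_cube R d) <= rho C)%E.
    rewrite le_measure ?inE//; first exact: measurable_closed_unit_cube.
    move=> u ucube; apply: UC; apply: contrapT => nu'; apply: nex; exists u; split => // k.
    by apply: contrapT => nk; apply: nu'; exists k.
  by rewrite rho1 C0 lee_fin ler10.
have nu' : ~ atoms mu' u by apply: (good_pairs_add_point smu' (nu := nu)); apply: Ggood; exact: (uG 0%N).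
have [sadd aadd] := atoms_add_point smu' nu'.
have nmuu : ~ atoms mu u by move=> muu; apply: nu'; rewrite amu'; left.
exists (u :: s); split.
  split => /=; [by rewrite sz| |].
    by rewrite us andbT; apply/negP => us'; apply: nu'; rewrite amu'; right.
  by move=> v; rewrite inE => /predU1P[->|/s_].
exists (add_point mu' u); split => //; rewrite aadd amu' -setUA; congr (_ `|` _).
apply/seteqP; split => v /=.
  by case=> [vs|->]; rewrite inE ?eqxx// vs orbT.
by rewrite inE => /predU1P[->|]; [right|left].
Qed.

(** The triangle inequalities in the two contradictions bound [|x|] by at most twice the matching
    distance plus one, where the summand one is the norm bound on the closed unit cube. *)
Definition long_reds (V1 V2 : set E) : set E :=
  [set x | V1 x /\ exists y, [/\ V2 y, stable_pair V1 V2 x y &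
                                 `|x| <= 3 * enorm (x - y) + 1]].

(** In the comparison [mu'] is the smaller red set: the surviving partner [x] of [y0] had an old
    partner at least as far away as [y0], so [x] was long and should have been removed. *)
Lemma deletion_contradiction (mu nu : N) (y0 : E) : slf mu -> slf nu ->
  (forall k, iter k (@delete_closure R d) (@good_pairs R d) (mu, nu)) ->
  chain_free (atoms mu `|` atoms nu) ->
  finite_set (long_reds (atoms mu) (atoms nu)) ->
  atoms nu y0 -> closed_unit_cube y0 -> False.
Proof.
move=> smu snu muG mufree finF nuy0 y0cube.
have /(good_pairsP smu snu) PP := muG 0%N.
have [mu' [smu' amu' mu'G]] := delete_points (fset_set (long_reds (atoms mu) (atoms nu))) smu muG.
have /(good_pairsP smu' snu) PP' := mu'G 0%N.
rewrite fset_setK// in amu'.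
have sub : atoms mu' `<=` atoms mu by rewrite amu' => x [].
have [x [[mu'x xy0] _]] := PP'.2 _ nuy0.
have [y [[nuy xy] _]] := PP.1 _ (sub _ mu'x).
have free' : chain_free (atoms mu' `|` atoms nu).
  by apply: chain_freeS mufree; exact: setSU.
have le := more_reds_push_reds_away sub PP' PP free' mu'x nuy0 nuy xy0 xy.
have : long_reds (atoms mu) (atoms nu) x.
  split; first exact: sub.
  exists y; split => //.
  have := ler_normD (x - y0) y0; rewrite subrK => h.
  have := closed_unit_cube_norm y0cube; have := norm_le_enorm (x - y0).
  have := enorm_ge0 (x - y0); lra.
by move: mu'x; rewrite amu' => -[].
Qed.

Lemma insertion_contradiction (rho : probability E R) (mu nu : N) :
  rho (@closed_unit_cube R d) = 1%E -> slf mu -> slf nu ->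
  (forall k, iter k (insert_closure rho) (@good_pairs R d) (mu, nu)) ->
  chain_free (atoms mu `|` atoms nu) ->
  finite_set (long_reds (atoms mu) (atoms nu)) -> False.
Proof.
move=> rho1 smu snu muG mufree finF.
set F := long_reds (atoms mu) (atoms nu) in finF.
have /(good_pairsP smu snu) PP := muG 0%N.
(* One point more than there are long reds, for the pigeonhole principle. *)
have [s [[sz us s_] [mu' [smu' amu' mu'G]]]] := insert_points (#|` fset_set F|).+1
  rho1 (@measurable_good_pairs R d) (@subset_refl _ _) smu muG.
have /(good_pairsP smu' snu) PP' := mu'G 0%N.
have sub : atoms mu `<=` atoms mu' by rewrite amu' => x; left.
(* [f u] is the red point from which the inserted [u] took its blue partner [y]. Since [y] was no
   closer to [f u] than to [u], that old pair was long. *)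
have /choice[f fP] u : exists x, u \in s -> exists2 y, atoms nu y &
    [/\ stable_pair (atoms mu') (atoms nu) u y, stable_pair (atoms mu) (atoms nu) x y & F x].
  have [us'|] := boolP (u \in s); last by exists 0.
  have mu'u : atoms mu' u by rewrite amu'; right.
  have [y [[nuy uy] _]] := PP'.1 _ mu'u.
  have [x [[mux xy] _]] := PP.2 _ nuy.
  exists x => _; exists y => //; split => //; split => //; exists y; split => //.
  have le := more_reds_bring_blues_closer sub PP PP' mufree nuy mux mu'u xy uy.
  have := ler_normD (x - y) y; rewrite subrK => h1.
  have := ler_normB u (u - y); rewrite opprB addrC subrK => h2.
  have := closed_unit_cube_norm (s_ u us').1; have := norm_le_enorm (x - y).
  have := norm_le_enorm (u - y); have := enorm_ge0 (x - y); lra.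
have finj : {in s &, injective f}.
  move=> u v us' vs fuv; have [y nuy [uy fuy [muf _]]] := fP u us'.
  have [z nuz [vz fvz [muf' _]]] := fP v vs.
  have yz : y = z by apply: (pair_inj_r PP muf nuy nuz fuy); rewrite fuv.
  apply: (pair_inj_l PP' (y := y)) => //; last by rewrite yz.
  - by rewrite amu'; right.
  - by rewrite amu'; right.
have : (size (map f s) <= size (fset_set F))%N.
  apply: uniq_leq_size; first by rewrite map_inj_in_uniq.
  move=> _ /mapP[u us' ->]; have [y _ [_ _ Ff]] := fP u us'.
  by rewrite in_fset_set// inE.
by rewrite size_map sz ltnn.
Qed.

End configurations.

Section tolerance_contradiction.
Context (R : realType) (d : nat).
Local Notation E := 'rV[R]_d.
Local Notation N := (Measures E R).
Context disp (Omega : measurableType disp) (P : probability Omega R).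

(** Emptiness is a translation-invariant event. If it had probability one, the intensity would be
    zero. *)
Lemma ergodic_nonempty (red : Omega -> N) : point_process (@bounded_rV R d) red ->
  ergodic P red -> (0 < intensity P red)%E ->
  {ae P, forall w, exists x, atoms (red w) x}.
Proof.
move=> [mred sred] [_ erg] int0.
pose Z := [set mu : N | (mu : measures E R) setT = 0%E].
have mZ : measurable Z.
  have mev : measurable_fun setT (fun mu : N => (mu : measures E R) setT) by exact: measurable_eval.
  by rewrite -[X in measurable X]setTI; exact: (mev measurableT [set 0%E] (emeasurable_set1 _)).
have mredZ : measurable (red @^-1` Z).
  by rewrite -[X in measurable X]setTI; exact: (mred measurableT _ mZ).
have [|PZ0|PZ1] := erg Z mZ.
- by move=> mu y _; rewrite /Z /translate /= /shifted /pushforward preimage_setT.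
- exists (red @^-1` Z); split => // w nex.
  apply/(simple_lf_eq0 (sred w)) => // x redx _; apply: nex; by exists x.
exfalso; suff : intensity P red = 0%E by move=> i0; rewrite i0 ltxx in int0.
rewrite /intensity /mean_measure; apply/integral_eq0_iff.
- exact: (measurableT_comp (measurable_eval (@measurable_closed_unit_cube R d)) mred).
- by move=> w; exact: measure_ge0.
apply/eqP; rewrite -measure_le0.
apply: (@le_trans _ _ (P (~` (red @^-1` Z)))).
  rewrite le_measure ?inE//; last 2 first.
  - exact: measurableC.
  - move=> w /= nz redZ; apply: nz; apply/eqP; rewrite -measure_le0 -redZ le_measure ?inE//.
    exact: measurable_closed_unit_cube.
  have mev : measurable_fun setT (fun w => (red w : measures E R) (@closed_unit_cube R d)).
    exact: (measurableT_comp (measurable_eval (@measurable_closed_unit_cube R d)) mred).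
  rewrite -[X in measurable X]setTI.
  exact: (mev measurableT _ (measurableC (emeasurable_set1 0%E))).
by rewrite probability_setC// PZ1 subee.
Qed.

Lemma ae_false : {ae P, forall _, False} -> False.
Proof.
move=> [A [mA PA0 TA]]; have : P setT = 0%E.
  by apply: (subset_measure0 _ mA _ PA0) => // w _; apply: TA => /=.
by rewrite probability_setT => /eqP; rewrite onee_eq0.
Qed.

(** Here [red] stands for the tolerant colour. Deletion excludes blue points from the unit cube,
    against their positive intensity, whereas insertion is contradictory for almost every sample. *)
Lemma tolerance_contradiction (red blue : Omega -> N) :
  point_process (@bounded_rV R d) red -> point_process (@bounded_rV R d) blue ->
  indep_rv P red blue -> ergodic P red ->
  (0 < intensity P red)%E -> (0 < intensity P blue)%E ->
  {ae P, forall w, perfectly_paired (atoms (red w)) (atoms (blue w))} ->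
  {ae P, forall w, chain_free (atoms (red w) `|` atoms (blue w))} ->
  {ae P, forall w, finite_set (long_reds (atoms (red w)) (atoms (blue w)))} ->
  deletion_tolerant P red \/ insertion_tolerant P red -> False.
Proof.
move=> red_pp blue_pp red_blue red_erg red0 blue0 PP free fin tol.
have good_full : full P red blue (@good_pairs R d).
  apply: full_ae => //; first exact: measurable_good_pairs.
  apply: filterS PP => w PPw.
  by apply/(good_pairsP (red_pp.2 w) (blue_pp.2 w)).
case: tol => tol.
  have nonempty := ergodic_nonempty red_pp red_erg red0.
  have ae := full_iter red_pp blue_pp
    (fun G => full_delete_closure red_pp blue_pp red_blue nonempty tol (G := G)) good_full.
  have noblue : {ae P, forall w, (blue w : measures E R) (@closed_unit_cube R d) = 0%E}.
    apply: filterS3 ae free fin => w Gw freew finw.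
    apply/(simple_lf_eq0 (blue_pp.2 w) (@measurable_closed_unit_cube R d)) => y bluey ycube.
    exact: (deletion_contradiction (red_pp.2 w) (blue_pp.2 w) Gw freew finw bluey ycube).
  suff : intensity P blue = 0%E by move=> i0; rewrite i0 ltxx in blue0.
  rewrite /intensity /mean_measure; apply/eqP; rewrite eq_le; apply/andP; split; last first.
    by apply: integral_ge0 => w _; exact: measure_ge0.
  rewrite -(integral0 P setT); apply: ae_ge0_le_integral => //.
  - exact: (measurableT_comp (measurable_eval (@measurable_closed_unit_cube R d)) blue_pp.1).
  - by apply: filterS noblue => w ->.
have [rho rhoE] := cube_probability R d.
have rho1 : rho (@closed_unit_cube R d) = 1%E.
  have mc := @measurable_closed_unit_cube R d.
  by rewrite -rhoE// setIid -[X in lebesgue_rV X]setTI rhoE// probability_setT.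
have ae := full_iter red_pp blue_pp
  (fun G => full_insert_closure red_pp blue_pp red_blue rhoE tol (G := G)) good_full.
apply: ae_false; apply: filterS3 ae free fin => w Gw freew finw.
exact: (insertion_contradiction rho1 (red_pp.2 w) (blue_pp.2 w) Gw freew finw).
Qed.

End tolerance_contradiction.

(** Passing from a blue point to its red partner costs one more matching distance, which turns the
    factor 3 into 4; the long blues are then the image of a finite set of reds under the pairing. *)
Lemma finite_long_redsC (R : realType) (d : nat) (V1 V2 : set 'rV[R]_d) :
  perfectly_paired V1 V2 ->
  finite_set [set x | V1 x /\ exists y, [/\ V2 y, stable_pair V1 V2 x y &
                                          `|x| <= 4 * enorm (x - y) + 1]] ->
  finite_set (long_reds V1 V2) /\ finite_set (long_reds V2 V1).
Proof.
move=> PP finS; split.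
  apply: sub_finite_set finS => x [V1x [y [V2y xy le]]]; split => //.
  by exists y; split => //; have := enorm_ge0 (x - y); lra.
apply: sub_finite_set (finite_image (fun x => xget 0 [set y | V2 y /\ stable_pair V1 V2 x y]) finS).
move=> y [V2y [x [V1x /stable_pairC xy le]]]; exists x; last first.
  by case: xgetP => [z _ [V2z xz]|/(_ y)[]//]; exact: (pair_inj_r PP V1x V2z V2y xz xy).
split => //; exists y; split => //.
have := ler_normD (x - y) y; rewrite subrK => h.
by have := norm_le_enorm (x - y); rewrite enorm_sym in le; lra.
Qed.

Theorem theorem8 (R : realType) (d : nat) (hd : (0 < d)%N)
  (disp : measure_display) (Omega : measurableType disp)
  (P : probability Omega R) (red blue : Omega -> Measures 'rV[R]_d R)
  (red_pp : point_process (@bounded_rV R d) red)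
  (blue_pp : point_process (@bounded_rV R d) blue)
  (red_blue_indep : indep_rv P red blue)
  (red_ergodic : ergodic P red) (blue_ergodic : ergodic P blue)
  (intensity_eq : intensity P red = intensity P blue)
  (intensity_gt0 : (0 < intensity P red)%E)
  (intensity_fin : (intensity P red < +oo)%E)
  (sum_simple :
    {ae P, forall w, simple_lf (@bounded_rV R d) (madd (red w) (blue w))})
  (sum_non_equidistant :
    {ae P, forall w, non_equidistant (madd (red w) (blue w))})
  (sum_no_chain : {ae P, forall w, ~ descending_chain (madd (red w) (blue w))})
  (tolerant : deletion_tolerant P red \/ deletion_tolerant P blue \/
              insertion_tolerant P red \/ insertion_tolerant P blue)
  (m : Omega -> Measures (Upair 'rV[R]_d) R)
  (m_stable : stable_matching_scheme P red blue m)
  (disp' : measure_display) (Omega' : measurableType disp')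
  (Q : probability Omega' R) (X : {RV Q >-> R})
  (X_cdf : forall r : R, 0 <= r -> cdf X r = matching_distance_cdf P red m r) :
  ('E_Q[fun w => (X w ^+ d)%R] = +oo)%E.
Proof.
have [[_ m_perfect] m_st] := m_stable.
have paired : {ae P, forall w,
    (perfectly_paired (atoms (red w)) (atoms (blue w)) /\
     forall x y, atoms (red w) x -> atoms (blue w) y ->
       stable_pair (atoms (red w)) (atoms (blue w)) x y ->
       partner (m w) x = y /\ 0 < enorm (x - y)) /\
    chain_free (atoms (red w) `|` atoms (blue w))}.
  apply: filterS2 (filterI m_perfect m_st) (filterI sum_non_equidistant sum_no_chain).
  move=> w [mp ms] [neq nch]; have sr := red_pp.2 w; have sb := blue_pp.2 w.
  split; last exact: (chain_free_atoms sr sb mp nch).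
  split; first exact: (perfectly_paired_atoms sr sb mp ms neq nch).
  move=> x y rx byy xy; split.
    exact: (stable_pair_partner sr sb mp ms neq nch rx byy xy).
  exact: (stable_pair_dist_gt0 mp rx byy).
have PP : {ae P, forall w, perfectly_paired (atoms (red w)) (atoms (blue w))}.
  by apply: filterS paired => w [[]].
have free : {ae P, forall w, chain_free (atoms (red w) `|` atoms (blue w))}.
  by apply: filterS paired => w [].
(* The intensity is taken over the closed cube, the normalisation of [F] over the half-open one. *)
have lam_fin : (mean_measure P red (@unit_cube R d) < +oo)%E.
  apply: le_lt_trans intensity_fin; apply: ge0_le_integral => //.
  - exact: (measurableT_comp (measurable_eval (@measurable_unit_cube R d)) red_pp.1).
  - exact: (measurableT_comp (measurable_eval (@measurable_closed_unit_cube R d)) red_pp.1).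
  move=> w _; rewrite le_measure ?inE//.
  - exact: (@measurable_unit_cube R d).
  - exact: measurable_closed_unit_cube.
  - by move=> x x01 i; have /andP[-> /ltW ->] := x01 i.
have paired1 : {ae P, forall w,
    perfectly_paired (atoms (red w)) (atoms (blue w)) /\
    forall x y, atoms (red w) x -> atoms (blue w) y ->
      stable_pair (atoms (red w)) (atoms (blue w)) x y ->
      partner (m w) x = y /\ 0 < enorm (x - y)}.
  by apply: filterS paired => w [].
apply: contrapT => X_moment.
have fin := ae_finite_long_pairs red_pp blue_pp red_blue_indep red_ergodic.1
  blue_ergodic.1 paired1 lam_fin X_cdf X_moment ler01.
have long : {ae P, forall w,
    finite_set (long_reds (atoms (red w)) (atoms (blue w))) /\
    finite_set (long_reds (atoms (blue w)) (atoms (red w)))}.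
  by apply: filterS2 PP fin => w; exact: finite_long_redsC.
have red_contra : deletion_tolerant P red \/ insertion_tolerant P red -> False.
  apply: (tolerance_contradiction red_pp blue_pp) => //.
  - by rewrite -intensity_eq.
  - by apply: filterS long => w [].
(* [F] measures distances from red points, so finiteness was obtained from the red side; the colours
   are exchanged only in its consequences. *)
have blue_contra : deletion_tolerant P blue \/ insertion_tolerant P blue -> False.
  apply: (tolerance_contradiction blue_pp red_pp) => //.
  - by move=> A B mA mB; rewrite setIC muleC; exact: red_blue_indep.
  - by rewrite -intensity_eq.
  - by apply: filterS PP => w; exact: perfectly_pairedC.
  - by apply: filterS free => w; rewrite setUC.
  - by apply: filterS long => w [].
case: tolerant => [del|[del|[ins|ins]]].
- by apply: red_contra; left.
- by apply: blue_contra; left.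
- by apply: red_contra; right.
- by apply: blue_contra; right.
Qed.
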